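(* Let $F\subset S^{2n-1}$ be nonempty. The suspension $S^X_0(F)$ is a formal Forelli suspension if and only if it has a nonsparse leaf.
   Context: Fix $n\ge1$ and $\lambda=(\lambda_1,\dots,\lambda_n)$ with $\lambda_1=1$, $\lambda_k>0$ for all $k$. For $z\in\mathbb{C}^n$, $t\in\mathbb{C}$ put $\Phi^X(z,t)=(z_1e^{-\lambda_1t},\dots,z_ne^{-\lambda_nt})$; $\mathbb{H}=\{\operatorname{Re}t>0\}$; $B^n$ the open unit ball, $S^{2n-1}$ its boundary. $S^X_0(F)=\{\Phi^X(z,t):z\in F,t\in\mathbb{H}\}$; for $z\in\bar F$ (closure in $S^{2n-1}$) its leaf is $L_z=\{\Phi^X(z,t):t\in\mathbb{H}\}$. A polynomial $q\in\mathbb{C}[z,\bar z]$ is quasi-homogeneous of type $\lambda$ with bidegree $(d_1,d_2)$ if $q(\Phi^X(z,t))=e^{-d_1t}e^{-d_2\bar t}q(z)$ for all $t\in\mathbb{H}$, $z\in\mathbb{C}^n$; $\mathcal{H}_\lambda$ is the set of such polynomials. The leaf $L_z$, $z\in\bar F$, is nonsparse if for every open neighborhood $U\subset S^{2n-1}$ of $z$ and every $q\in\mathcal{H}_\lambda$ of bidegree $(d_1,d_2)$ with $d_2\ne0$ and $\bar F\cap U\subset\{q=0\}$, one has $q\equiv0$ on $\mathbb{C}^n$. $S^X_0(F)$ is a formal Forelli suspension if every $f:B^n\to\mathbb{C}$ with (1) $f\in C^\infty(0)$ (for each $k$, $f$ is $C^k$ on some neighborhood of $0$) and (2) $t\in\mathbb{H}\mapsto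 f(\Phi^X(z,t))$ holomorphic for each $z\in F$, has formal Taylor series $\sum a_{km}z^k\bar z^m$, $a_{km}=\frac{1}{k!m!}\frac{\partial^{|k|+|m|}f}{\partial z^k\partial\bar z^m}(0)$, with $a_{km}=0$ whenever $m\ne0$. *)

(* Defs.v *)
From Stdlib Require Import Reals.
From Coquelicot Require Import Coquelicot.
From mathcomp Require Import ssreflect ssrbool ssrnat eqtype fintype.

Set Implicit Arguments.
Unset Strict Implicit.

Local Open Scope R_scope.

Definition Cn (n : nat) := 'I_n -> C.

Definition csum (n : nat) (g : 'I_n -> C) : C :=
  List.fold_right (fun j acc => Cplus (g j) acc) (RtoC 0) (enum 'I_n).
Definition cprod (n : nat) (g : 'I_n -> C) : C :=
  List.fold_right (fun j acc => Cmult (g j) acc) (RtoC 1) (enum 'I_n).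
Definition rsum (n : nat) (g : 'I_n -> R) : R :=
  List.fold_right (fun j acc => g j + acc) 0 (enum 'I_n).
Definition nprod (n : nat) (g : 'I_n -> nat) : nat :=
  List.fold_right (fun j acc => (g j * acc)%nat) 1%nat (enum 'I_n).

Definition cpow (c : C) (k : nat) : C := Nat.iter k (Cmult c) (RtoC 1).

Definition cexp (w : C) : C := (exp (Re w) * cos (Im w), exp (Re w) * sin (Im w)).

Definition Phi (n : nat) (lam : 'I_n -> R) (z : Cn n) (t : C) : Cn n :=
  fun j => Cmult (z j) (cexp (Cmult (RtoC (- lam j)) t)).

Definition Hplane (t : C) : Prop := 0 < Re t.

Definition sphere (n : nat) (z : Cn n) : Prop := rsum (fun j => Cmod (z j) ^ 2) = 1.

(** sup-norm boxes (they define the usual topology of C^n) *)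
Definition near_pt (n : nat) (z w : Cn n) (d : R) : Prop :=
  forall j, Cmod (Cminus (w j) (z j)) < d.

Definition openC (n : nat) (U : Cn n -> Prop) : Prop :=
  forall z, U z -> exists d, 0 < d /\ forall w, near_pt z w d -> U w.

Definition rel_open_sphere (n : nat) (U : Cn n -> Prop) : Prop :=
  (forall z, U z -> sphere z) /\
  forall z, U z -> exists d, 0 < d /\ forall w, sphere w -> near_pt z w d -> U w.

Definition closureS (n : nat) (F : Cn n -> Prop) (z : Cn n) : Prop :=
  sphere z /\ forall d, 0 < d -> exists w, F w /\ near_pt z w d.

Definition cont_on (n : nat) (U : Cn n -> Prop) (f : Cn n -> C) : Prop :=
  forall z, U z -> forall e, 0 < e -> exists d, 0 < d /\
    forall w, near_pt z w d -> Cmod (Cminus (f w) (f z)) < e.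

Definition shift (n : nat) (z : Cn n) (j : 'I_n) (c : C) : Cn n :=
  fun i => if i == j then Cplus (z i) c else z i.

Definition dx (n : nat) (j : 'I_n) (f : Cn n -> C) : Cn n -> C :=
  fun z => (Derive (fun s => Re (f (shift z j (RtoC s)))) 0,
            Derive (fun s => Im (f (shift z j (RtoC s)))) 0).
Definition dy (n : nat) (j : 'I_n) (f : Cn n -> C) : Cn n -> C :=
  fun z => (Derive (fun s => Re (f (shift z j (0, s)))) 0,
            Derive (fun s => Im (f (shift z j (0, s)))) 0).

Definition partials_exist (n : nat) (j : 'I_n) (f : Cn n -> C) (z : Cn n) : Prop :=
  ex_derive (fun s => Re (f (shift z j (RtoC s)))) 0 /\
  ex_derive (fun s => Im (f (shift z j (RtoC s)))) 0 /\
  ex_derive (fun s => Re (f (shift z j (0, s)))) 0 /\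
  ex_derive (fun s => Im (f (shift z j (0, s)))) 0.

Fixpoint Ck_on (n : nat) (k : nat) (U : Cn n -> Prop) (f : Cn n -> C) : Prop :=
  match k with
  | O => cont_on U f
  | S k' => cont_on U f /\
      forall j : 'I_n, (forall z, U z -> partials_exist j f z) /\
        Ck_on k' U (dx j f) /\ Ck_on k' U (dy j f)
  end.

Definition Cinf_at0 (n : nat) (f : Cn n -> C) : Prop :=
  forall k : nat, exists U, openC U /\ U (fun _ => RtoC 0) /\ Ck_on k U f.

Definition dz (n : nat) (j : 'I_n) (f : Cn n -> C) : Cn n -> C :=
  fun z => Cmult (RtoC (/2)) (Cminus (dx j f z) (Cmult Ci (dy j f z))).
Definition dzb (n : nat) (j : 'I_n) (f : Cn n -> C) : Cn n -> C :=
  fun z => Cmult (RtoC (/2)) (Cplus (dx j f z) (Cmult Ci (dy j f z))).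

Definition Dkm (n : nat) (k m : 'I_n -> nat) (f : Cn n -> C) : Cn n -> C :=
  List.fold_right (fun j g => Nat.iter (k j) (dz j) g)
    (List.fold_right (fun j g => Nat.iter (m j) (dzb j) g) f (enum 'I_n))
    (enum 'I_n).

Definition taylor_coef (n : nat) (f : Cn n -> C) (k m : 'I_n -> nat) : C :=
  Cmult (RtoC (/ (INR (nprod (fun j => (k j)`!)) * INR (nprod (fun j => (m j)`!)))))
        (Dkm k m f (fun _ => RtoC 0)).

Definition C_differentiable (g : C -> C) (t : C) : Prop :=
  exists l : C, forall e, 0 < e -> exists d, 0 < d /\
    forall h : C, h <> RtoC 0 -> Cmod h < d ->
      Cmod (Cminus (Cdiv (Cminus (g (Cplus t h)) (g t)) h) l) < e.

Definition formal_Forelli (n : nat) (lam : 'I_n -> R) (F : Cn n -> Prop) : Prop :=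
  forall f : Cn n -> C,
    Cinf_at0 f ->
    (forall z, F z -> forall t, Hplane t -> C_differentiable (fun s => f (Phi lam z s)) t) ->
    forall k m : 'I_n -> nat, (exists j, m j <> 0%nat) -> taylor_coef f k m = RtoC 0.

Definition monomial (n : nat) (a b : 'I_n -> nat) (z : Cn n) : C :=
  cprod (fun j => Cmult (cpow (z j) (a j)) (cpow (Cconj (z j)) (b j))).

Definition is_poly_zzbar (n : nat) (q : Cn n -> C) : Prop :=
  exists s : list (C * (('I_n -> nat) * ('I_n -> nat))),
    forall z, q z = List.fold_right
                      (fun tm acc => Cplus (Cmult (fst tm) (monomial (fst (snd tm)) (snd (snd tm)) z)) acc)
                      (RtoC 0) s.

Definition quasi_hom (n : nat) (lam : 'I_n -> R) (q : Cn n -> C) (d1 d2 : R) : Prop :=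
  is_poly_zzbar q /\
  forall t, Hplane t -> forall z,
    q (Phi lam z t) =
      Cmult (Cmult (cexp (Cmult (RtoC (- d1)) t)) (cexp (Cmult (RtoC (- d2)) (Cconj t)))) (q z).

(** the leaf L_z (z in closure of F) is nonsparse *)
Definition nonsparse_leaf (n : nat) (lam : 'I_n -> R) (F : Cn n -> Prop) (z : Cn n) : Prop :=
  forall U : Cn n -> Prop, rel_open_sphere U -> U z ->
  forall (q : Cn n -> C) (d1 d2 : R), quasi_hom lam q d1 d2 -> d2 <> 0 ->
    (forall w, closureS F w -> U w -> q w = RtoC 0) ->
    forall w, q w = RtoC 0.

(* Main.v *)
(* Write [f o Phi(z, .)] as a sum of exponentials [exp(-d1 t - d2 conj t)] with coefficients the
   quasi-homogeneous parts [q_(d1,d2)(z)] of a Taylor polynomial of [f], up to a remainder that is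
   small together with its first derivatives as [Re t -> oo].  Holomorphy along the leaf kills the
   d-bar derivative of this sum; since exponentials of different bidegree are independent modulo
   fast decaying functions, [q_(d1,d2)] vanishes on [F], hence on its closure, whenever [d2 <> 0],
   and one nonsparse leaf forces [q_(d1,d2) = 0].
   Conversely, if every leaf is sparse, compactness yields finitely many nonzero quasi-homogeneous
   polynomials with [d2 > 0] whose zero sets cover [F].  Their product [q] vanishes on all leaves,
   so [f := q] is an admissible test function, and its Taylor series is not holomorphic. *)
Require Import Defs.
From Stdlib Require Import Reals Lra Lia FunctionalExtensionality ClassicalEpsilon.
From Coquelicot Require Import Coquelicot.
From mathcomp Require Import ssreflect ssrfun ssrbool eqtype ssrnat seq path fintype finfun bigop.

Set Implicit Arguments.
Unset Strict Implicit.

Local Open Scope R_scope.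

(** Smoothness at the origin lets the neighborhood shrink with the order, so identities between
    derivatives hold only as equalities of germs and are used by evaluating at the origin. Let [mu]
    be a positive lower bound of the [lam j]. Points of a leaf have size O(exp(-mu Re t)), so a
    remainder flat to order N decays like exp(-N mu Re t). Taking N mu > d1 + d2 makes the
    exponential of bidegree (d1, d2) dominate the error. The derivative of the remainder along the
    leaf is not computed: a Lipschitz bound on small boxes controls it. In the converse, second
    degrees add under products, and d2 <> 0 alone could cancel. But a nonzero quasi-homogeneous
    polynomial has d2 >= 0, since d2 is the weight of one of its monomials, and positivity survives
    products. That the Taylor series of q is not holomorphic is again read off along a leaf: if all
    coefficients with m <> 0 vanished, the jet of q would contain no exponential of bidegree (d1,
    d2), while q itself is q(w) times that exponential. So the given terms of q, among which
    exponents may repeat, are never matched with Taylor coefficients. *)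

Lemma Cmod_le_ReIm (c : C) : Cmod c <= Rabs (Re c) + Rabs (Im c).
Proof.
have ha := Rabs_pos (Re c); have hb := Rabs_pos (Im c).
rewrite -[X in _ <= X](sqrt_pow2 (Rabs (Re c) + Rabs (Im c))); last by lra.
apply: sqrt_le_1_alt; rewrite -/(Re c) -/(Im c).
have := pow2_abs (Re c); have := pow2_abs (Im c); nra.
Qed.

Lemma im_le_Cmod (c : C) : Rabs (Im c) <= Cmod c.
Proof. exact: Rle_trans (Rmax_r _ _) (Rmax_Cmod c). Qed.

Lemma Cmod_Ci : Cmod Ci = 1.
Proof. rewrite /Cmod /= -[RHS]sqrt_1; f_equal; ring. Qed.

Lemma Ci_sqr : (Ci * Ci)%C = (- RtoC 1)%C.
Proof. rewrite /Ci /Cmult /RtoC /Copp /=; f_equal; ring. Qed.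

Lemma Cminus_eq0 (a b : C) : (a - b)%C = RtoC 0 -> a = b.
Proof. by move=> h; have -> : a = (a - b + b)%C; [ring | rewrite h; ring]. Qed.

Lemma Cmod_minus_sym (a b : C) : Cmod (a - b) = Cmod (b - a).
Proof. rewrite -Cmod_opp; f_equal; ring. Qed.

(** * Derivatives of curves [R -> C] *)

(** Real and imaginary parts are kept apart because [dx] and [dy] are built from [Derive] of each of
    them. *)
Definition isd (g : R -> C) (x : R) (l : C) : Prop :=
  is_derive (fun s => Re (g s)) x (Re l) /\ is_derive (fun s => Im (g s)) x (Im l).

Lemma isd_ext (g h : R -> C) (x : R) (l : C) : (forall s, g s = h s) -> isd g x l -> isd h x l.
Proof. by move=> e; have -> : h = g by apply: functional_extensionality => s; rewrite e. Qed.

Lemma isd_const c (x : R) : isd (fun _ => c) x (RtoC 0).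
Proof. by split; apply: is_derive_const. Qed.

Lemma isd_plus (g h : R -> C) (x : R) (l m : C) : isd g x l -> isd h x m -> isd (fun s => g s + h s)%C x (l + m)%C.
Proof. by move=> [a b] [c d]; split; apply: is_derive_plus. Qed.

Lemma is_derive_val (f : R -> R) (x : R) (l l' : R) : is_derive f x l -> l = l' -> is_derive f x l'.
Proof. by move=> h <-. Qed.

Lemma isd_val (g : R -> C) (x : R) (l l' : C) : isd g x l -> l = l' -> isd g x l'.
Proof. by move=> h <-. Qed.

Lemma isd_mult (g h : R -> C) (x : R) (l m : C) : isd g x l -> isd h x m ->
  isd (fun s => g s * h s)%C x (l * h x + g x * m)%C.
Proof.
move=> [a b] [c d]; split.
- apply: is_derive_val.
    apply: is_derive_minus; apply: is_derive_mult; try eassumption; exact: Rmult_comm.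
  by rewrite /minus /plus /mult /opp /Re /Im /=; ring.
- apply: is_derive_val.
    apply: is_derive_plus; apply: is_derive_mult; try eassumption; exact: Rmult_comm.
  by rewrite /plus /mult /Re /Im /=; ring.
Qed.

Lemma isd_scal c (g : R -> C) (x : R) (l : C) : isd g x l -> isd (fun s => c * g s)%C x (c * l)%C.
Proof. by move=> h; apply: isd_val (isd_mult (isd_const c x) h) _; ring. Qed.

Lemma isd_conj (g : R -> C) (x : R) (l : C) : isd g x l -> isd (fun s => Cconj (g s)) x (Cconj l).
Proof. by move=> [a b]; split => //=; apply: is_derive_opp b. Qed.

Lemma isd_pow (g : R -> C) (x : R) (l : C) k : isd g x l ->
  isd (fun s => cpow (g s) k) x (RtoC (INR k) * cpow (g x) k.-1 * l)%C.
Proof.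
move=> h; elim: k => [|k ih].
  apply: isd_val (isd_const _ _) _ => /=; ring.
apply: isd_val (isd_mult h ih) _.
case: k ih => [|k] _; first by rewrite /=; ring.
rewrite (S_INR k.+1) RtoC_plus /=; ring.
Qed.

Lemma isd_RtoC (x : R) : isd RtoC x (RtoC 1).
Proof. by split; [apply: is_derive_id | apply: is_derive_const]. Qed.

Lemma isd_id (x : R) c : isd (fun s => c * RtoC s)%C x c.
Proof. by apply: isd_val (isd_scal c (isd_RtoC x)) _; ring. Qed.

Lemma isd_translate (g : R -> C) (x : R) (l : C) : isd g x l <-> isd (fun s => g (x + s)) 0 l.
Proof.
have aux (f : R -> R) m : is_derive f x m <-> is_derive (fun s => f (x + s)) 0 m.
  rewrite !is_derive_Reals; split=> h e he; have [d hd] := h e he; exists d => k k0 kd.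
    by rewrite Rplus_0_r Rplus_0_l; apply: hd.
  by have := hd k k0 kd; rewrite Rplus_0_r Rplus_0_l.
by split=> -[a b]; split; apply/(aux (fun s => Re (g s))) || apply/(aux (fun s => Im (g s))).
Qed.

Lemma isd_of_quotients (g : R -> C) (x : R) (l : C) :
  (forall e, 0 < e -> exists d, 0 < d /\ forall h, h <> 0 -> Rabs h < d ->
     Cmod ((g (x + h)%R - g x) / RtoC h - l)%C < e) -> isd g x l.
Proof.
move=> H; split; apply/is_derive_Reals => e he; have [d [d0 hd]] := H e he;
  exists (mkposreal d d0) => t t0 ht; have := hd t t0 ht;
  apply: Rle_lt_trans.
- apply: Rle_trans (re_le_Cmod _); apply: Req_le; f_equal.
  by rewrite /Cdiv -RtoC_inv // /Re /Im /= /Rdiv; ring.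
- apply: Rle_trans (im_le_Cmod _); apply: Req_le; f_equal.
  by rewrite /Cdiv -RtoC_inv // /Re /Im /= /Rdiv; ring.
Qed.

Lemma isd_approx (g : R -> C) (x : R) (l : C) e : isd g x l -> 0 < e -> exists d, 0 < d /\ forall h, Rabs h < d ->
   Cmod (g (x + h)%R - g x - l * RtoC h)%C <= e * Rabs h.
Proof.
move=> [/is_derive_Reals A /is_derive_Reals B] e0.
have e2 : 0 < e / 2 by lra.
have [d1 h1] := A _ e2; have [d2 h2] := B _ e2.
exists (Rmin d1 d2); split; first by apply: Rmin_case; apply: cond_pos.
move=> h hh.
case: (Req_dec h 0) => [->|h0].
  rewrite Rabs_R0 Rplus_0_r Rmult_0_r.
  have -> : (g x - g x - l * RtoC 0)%C = RtoC 0 by ring.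
  rewrite Cmod_0; lra.
have a1 := h1 h h0 (Rlt_le_trans _ _ _ hh (Rmin_l _ _)).
have a2 := h2 h h0 (Rlt_le_trans _ _ _ hh (Rmin_r _ _)).
apply: Rle_trans (Cmod_le_ReIm _) _.
have hp := Rabs_pos_lt _ h0.
have -> : Re (g (x + h)%R - g x - l * RtoC h)%C =
   ((Re (g (x + h)%R) - Re (g x)) / h - Re l) * h by rewrite /Re /Im /=; field.
have -> : Im (g (x + h)%R - g x - l * RtoC h)%C =
   ((Im (g (x + h)%R) - Im (g x)) / h - Im l) * h by rewrite /Re /Im /=; field.
rewrite !Rabs_mult; nra.
Qed.

(** A local Lipschitz constant bounds the derivative. This is how the Lipschitz estimate of a Taylor
    remainder becomes an estimate of its derivative along a leaf. *)
Lemma isd_le (g : R -> C) (x : R) (l : C) B : isd g x l ->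
  (exists d, 0 < d /\ forall h, Rabs h < d -> Cmod (g (x + h)%R - g x)%C <= B * Rabs h) ->
  Cmod l <= B.
Proof.
move=> H [d [d0 hd]]; apply: le_epsilon => e e0.
have [d' [d'0 hd']] := isd_approx H e0.
set h := Rmin d d' / 2.
have m0 : 0 < Rmin d d' by apply: Rmin_case.
have h0 : 0 < h by rewrite /h; lra.
have ah : Rabs h = h by apply: Rabs_pos_eq; lra.
have hd1 : Rabs h < d by rewrite ah; have := Rmin_l d d'; rewrite /h; lra.
have hd2 : Rabs h < d' by rewrite ah; have := Rmin_r d d'; rewrite /h; lra.
have a1 := hd _ hd1; have a2 := hd' _ hd2.
have : Cmod (l * RtoC h)%C <= (B + e) * h.
  have -> : (l * RtoC h = (g (x + h)%R - g x) - (g (x + h)%R - g x - l * RtoC h))%C by ring.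
  apply: Rle_trans (Cmod_triangle _ _) _; rewrite Cmod_opp.
  rewrite ah in a1 a2; lra.
rewrite Cmod_mult Cmod_R ah => a3.
by apply: Rmult_le_reg_r a3.
Qed.

(** The mean value theorem fails for complex values; it is applied to [Re] and [Im] separately,
    whence the factor 2. *)
Lemma mvt_Cmod (g : R -> C) a b K :
  (forall s, Rmin a b <= s <= Rmax a b -> exists l, isd g s l /\ Cmod l <= K) ->
  Cmod (g b - g a)%C <= 2 * K * Rabs (b - a).
Proof.
move=> H.
have real (p : C -> R) : (forall c, Rabs (p c) <= Cmod c) ->
    (forall s l, isd g s l -> is_derive (fun s => p (g s)) s (p l)) ->
    Rabs (p (g b) - p (g a)) <= K * Rabs (b - a).
  move=> hp hd.
  have D s : Rmin a b <= s <= Rmax a b -> is_derive (fun s => p (g s)) s (Derive (fun s => p (g s)) s).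
    move=> /H [l [hl _]]; apply: Derive_correct; exists (p l); exact: hd.
  have [||c [hc ->]] := @MVT_gen (fun s => p (g s)) a b (fun s => Derive (fun s => p (g s)) s).
  - by move=> s hs; apply: D; lra.
  - move=> s hs; apply: derivable_continuous_pt.
    exists (Derive (fun s => p (g s)) s); apply/is_derive_Reals; exact: D.
  - have [l [hl lK]] := H c hc.
    rewrite (is_derive_unique _ _ _ (hd _ _ hl)) Rabs_mult.
    apply: Rmult_le_compat_r; first exact: Rabs_pos.
    exact: Rle_trans (hp l) lK.
have r1 := real Re re_le_Cmod (fun s l => @proj1 _ _).
have r2 := real Im im_le_Cmod (fun s l => @proj2 _ _).
apply: Rle_trans (Cmod_le_ReIm _) _.
by rewrite /= -!/(Rminus _ _); rewrite /Re /Im in r1 r2; lra.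
Qed.

(** * Coordinate directions and germs at the origin *)

(* [(j, false)] is the direction of [x_j], [(j, true)] that of [y_j]; as labels of Wirtinger
   derivatives they stand for [z_j] and [conj z_j]. *)
Notation dir n := ('I_n * bool)%type.

Definition unit_of (b : bool) : C := if b then Ci else RtoC 1.

Definition move (n : nat) (z : Cn n) (d : dir n) (s : R) : Cn n :=
  shift z d.1 (unit_of d.2 * RtoC s)%C.

Definition pd (n : nat) (d : dir n) (f : Cn n -> C) : Cn n -> C :=
  if d.2 then dy d.1 f else dx d.1 f.

Definition box (n : nat) (r : R) (z : Cn n) : Prop := forall j, Cmod (z j) < r.

Definition origin (n : nat) : Cn n := fun _ => RtoC 0.

Definition partial_at (n : nat) (d : dir n) (f : Cn n -> C) (z : Cn n) : Prop :=
  exists l, isd (fun s => f (move z d s)) 0 l.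

Lemma unit_ofE (b : bool) (s : R) : (unit_of b * RtoC s)%C = if b then (0, s) else RtoC s.
Proof. by case: b; rewrite /unit_of /Ci /RtoC /Cmult /=; f_equal; ring. Qed.

Lemma Cmod_unit_of b : Cmod (unit_of b) = 1.
Proof. by case: b; rewrite /= ?Cmod_Ci ?Cmod_1. Qed.

Lemma pd_E n (d : dir n) f z :
  pd d f z = (Derive (fun s => Re (f (move z d s))) 0, Derive (fun s => Im (f (move z d s))) 0).
Proof.
by case: d => j [] /=; rewrite /pd /dx /dy /=; f_equal; apply: Derive_ext => s;
  rewrite /move unit_ofE.
Qed.

Lemma move0 n (z : Cn n) d : move z d 0 = z.
Proof.
apply: functional_extensionality => i; rewrite /move /shift; case: eqP => // _.
by rewrite Cmult_0_r Cplus_0_r.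
Qed.

Lemma move_move n (z : Cn n) d s t : move (move z d s) d t = move z d (s + t).
Proof.
apply: functional_extensionality => i; rewrite /move /shift; case: eqP => // _.
by rewrite RtoC_plus; ring.
Qed.

Lemma moveC n (z : Cn n) d e s t : move (move z d s) e t = move (move z e t) d s.
Proof.
apply: functional_extensionality => i; rewrite /move /shift.
by case: eqP => // _; case: eqP => // _; ring.
Qed.

Lemma Cmod_move n (z : Cn n) d s j : Cmod (move z d s j - z j)%C <= Rabs s.
Proof.
rewrite /move /shift; case: eqP => _; last first.
  have -> : (z j - z j)%C = RtoC 0 by ring.
  by rewrite Cmod_0; apply: Rabs_pos.
have -> : (z j + unit_of d.2 * RtoC s - z j = unit_of d.2 * RtoC s)%C by ring.
by rewrite Cmod_mult Cmod_unit_of Cmod_R Rmult_1_l; apply: Rle_refl.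
Qed.

Lemma near_move n (z : Cn n) d s r : Rabs s < r -> near_pt z (move z d s) r.
Proof. by move=> h j; apply: Rle_lt_trans (Cmod_move _ _ _ _) h. Qed.

Lemma near_pt_trans n (x y z : Cn n) r s :
  near_pt x y r -> near_pt y z s -> near_pt x z (r + s).
Proof.
move=> h k j; have -> : (z j - x j = (y j - x j) + (z j - y j))%C by ring.
by apply: Rle_lt_trans (Cmod_triangle _ _) _; have := h j; have := k j; lra.
Qed.

Lemma near_pt_le n (x y : Cn n) r s : r <= s -> near_pt x y r -> near_pt x y s.
Proof. by move=> h k j; apply: Rlt_le_trans (k j) h. Qed.

Lemma near_pt_refl n (x : Cn n) r : 0 < r -> near_pt x x r.
Proof. by move=> h j; have -> : (x j - x j)%C = RtoC 0; [ring | rewrite Cmod_0]. Qed.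

Lemma near_origin n (w : Cn n) r : near_pt (@origin n) w r <-> box r w.
Proof.
by split=> h j; have := h j; rewrite /origin; have -> : (w j - 0 = w j)%C by ring.
Qed.

Lemma box_le n r s (z : Cn n) : r <= s -> box r z -> box s z.
Proof. by move=> h k j; apply: Rlt_le_trans (k j) h. Qed.

Lemma box_origin n r : 0 < r -> box r (@origin n).
Proof. by move=> h j; rewrite Cmod_0. Qed.

(** The minimum of finitely many positive radii, one per coordinate. Stated for a property inherited
    by smaller radii, it also serves to merge other constants, after inversion if they are upper
    bounds. *)
Lemma ord_uniform_pos n (P : 'I_n -> R -> Prop) :
  (forall j r s, 0 < s <= r -> P j r -> P j s) ->
  (forall j, exists r, 0 < r /\ P j r) -> exists r, 0 < r /\ forall j, P j r.
Proof.
move=> mono H.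
suff [r [r0 hr]] : exists r, 0 < r /\ forall j, j \in enum 'I_n -> P j r.
  by exists r; split=> // j; apply: hr; rewrite mem_enum.
elim: (enum 'I_n) => [|i l [r [r0 hr]]]; first by exists 1; split; [lra|].
have [s [s0 hs]] := H i.
have m0 : 0 < Rmin r s by apply: Rmin_case.
exists (Rmin r s); split=> // j; rewrite inE => /orP [/eqP ->|jl].
  by apply: mono hs; split=> //; apply: Rmin_r.
by apply: mono (hr _ jl); split=> //; apply: Rmin_l.
Qed.

Lemma openC_box n r : openC (@box n r).
Proof.
move=> z hz.
have [|j|d [d0 hd]] := @ord_uniform_pos n (fun j d => Cmod (z j) + d <= r).
- by move=> j a b h k; lra.
- by exists (r - Cmod (z j)); have := hz j; lra.
exists d; split=> // w hw j.
have -> : (w j = (w j - z j) + z j)%C by ring.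
by apply: Rle_lt_trans (Cmod_triangle _ _) _; have := hd j; have := hw j; lra.
Qed.

Lemma partials_existE n j (f : Cn n -> C) z :
  partials_exist j f z <-> forall b, partial_at (j, b) f z.
Proof.
have E b : (fun s => f (move z (j, b) s)) = (fun s => f (shift z j (if b then (0, s) else RtoC s))).
  by apply: functional_extensionality => s; rewrite /move unit_ofE.
rewrite /partial_at; split.
- move=> [[a ha] [[b hb] [[c hc] [d hd]]]] [].
  + by rewrite E; exists (c, d); split.
  + by rewrite E; exists (a, b); split.
- move=> H; have := H true; have := H false; rewrite !E => -[l [l1 l2]] [m [m1 m2]].
  by split; [exists (Re l) | split; [exists (Im l) | split; [exists (Re m) | exists (Im m)]]].
Qed.

Lemma isd_D n d (f : Cn n -> C) z l : isd (fun s => f (move z d s)) 0 l -> pd d f z = l.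
Proof.
move=> [a b]; rewrite pd_E (is_derive_unique _ _ _ a) (is_derive_unique _ _ _ b).
by case: l {a b}.
Qed.

Lemma pd_isd n d (f : Cn n -> C) z : partial_at d f z -> isd (fun s => f (move z d s)) 0 (pd d f z).
Proof. by move=> [l h]; rewrite (isd_D h). Qed.

Lemma pd_isd_at n d (f : Cn n -> C) z s : partial_at d f (move z d s) ->
  isd (fun s => f (move z d s)) s (pd d f (move z d s)).
Proof.
move=> h; apply/isd_translate; apply: isd_ext (pd_isd h) => t.
by rewrite move_move.
Qed.

Lemma pd_ext n d (f g : Cn n -> C) z :
  (exists r, 0 < r /\ forall w, near_pt z w r -> f w = g w) -> pd d f z = pd d g z.
Proof.
move=> [r [r0 hr]]; rewrite !pd_E.
have L : locally 0 (fun s => f (move z d s) = g (move z d s)).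
  exists (mkposreal r r0) => s hs; apply: hr; apply: near_move.
  by move: hs; rewrite /ball /= /AbsRing_ball /abs /minus /plus /opp /= Ropp_0 Rplus_0_r.
by f_equal; apply: Derive_ext_loc; apply: filter_imp L => s ->.
Qed.

Lemma partial_at_ext n d (f g : Cn n -> C) z :
  (exists r, 0 < r /\ forall w, near_pt z w r -> f w = g w) -> partial_at d f z -> partial_at d g z.
Proof.
move=> [r [r0 hr]] [l [a b]]; exists l.
have L : locally 0 (fun s => f (move z d s) = g (move z d s)).
  exists (mkposreal r r0) => s hs; apply: hr; apply: near_move.
  by move: hs; rewrite /ball /= /AbsRing_ball /abs /minus /plus /opp /= Ropp_0 Rplus_0_r.
by split; [apply: is_derive_ext_loc a | apply: is_derive_ext_loc b]; apply: filter_imp L => s ->.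
Qed.

Lemma isd_lin (a b : C) (g h : R -> C) x l m :
  isd g x l -> isd h x m -> isd (fun s => a * g s + b * h s)%C x (a * l + b * m)%C.
Proof. by move=> hg hh; apply: isd_plus; apply: isd_scal. Qed.

Lemma pd_lin n d (a b : C) (f g : Cn n -> C) z : partial_at d f z -> partial_at d g z ->
  pd d (fun w => a * f w + b * g w)%C z = (a * pd d f z + b * pd d g z)%C.
Proof. by move=> hf hg; apply: isd_D; apply: isd_lin; apply: pd_isd. Qed.

Lemma partial_at_lin n d (a b : C) (f g : Cn n -> C) z : partial_at d f z -> partial_at d g z ->
  partial_at d (fun w => a * f w + b * g w)%C z.
Proof. by move=> [l hl] [m hm]; eexists; apply: isd_lin hl hm. Qed.

Definition cont_at (n : nat) (f : Cn n -> C) (z : Cn n) : Prop :=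
  forall e, 0 < e -> exists d, 0 < d /\ forall w, near_pt z w d -> Cmod (f w - f z)%C < e.

Lemma cont_at_const n c (z : Cn n) : cont_at (fun _ => c) z.
Proof.
move=> e e0; exists 1; split; first lra; move=> w _.
by have -> : (c - c)%C = RtoC 0; [ring | rewrite Cmod_0].
Qed.

Lemma cont_at_plus n (f g : Cn n -> C) z : cont_at f z -> cont_at g z ->
  cont_at (fun w => f w + g w)%C z.
Proof.
move=> hf hg e e0; have e2 : 0 < e / 2 by lra.
have [d [d0 hd]] := hf _ e2; have [d' [d'0 hd']] := hg _ e2.
exists (Rmin d d'); split; first exact: Rmin_case.
move=> w hw; have -> : (f w + g w - (f z + g z) = (f w - f z) + (g w - g z))%C by ring.
have := hd _ (near_pt_le (Rmin_l _ _) hw); have := hd' _ (near_pt_le (Rmin_r _ _) hw).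
by have := Cmod_triangle (f w - f z) (g w - g z); lra.
Qed.

Lemma cont_at_mult n (f g : Cn n -> C) z : cont_at f z -> cont_at g z ->
  cont_at (fun w => f w * g w)%C z.
Proof.
move=> hf hg e e0.
set A := Cmod (f z); set B := Cmod (g z).
have A0 : 0 <= A by apply: Cmod_ge_0.
have B0 : 0 <= B by apply: Cmod_ge_0.
(* With both increments below [k < 1], the product changes by at most
   [k * k + A * k + B * k <= k * (A + B + 1)], which is below [e]; the summand [e] in the
   denominator forces [k < 1]. *)
set k := e / (A + B + 1 + e).
have den : 0 < A + B + 1 + e by lra.
have k0 : 0 < k by apply: Rdiv_lt_0_compat.
have ke : k * (A + B + 1 + e) = e by rewrite /k; field; lra.
have k1 : k < 1 by apply: (Rmult_lt_reg_r (A + B + 1 + e)) => //; rewrite ke; lra.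
have [d [d0 hd]] := hf _ k0; have [d' [d'0 hd']] := hg _ k0.
exists (Rmin d d'); split; first exact: Rmin_case.
move=> w hw.
have -> : (f w * g w - f z * g z
   = (f w - f z) * (g w - g z) + f z * (g w - g z) + (f w - f z) * g z)%C by ring.
have h1 := hd _ (near_pt_le (Rmin_l _ _) hw); have h2 := hd' _ (near_pt_le (Rmin_r _ _) hw).
have t1 := Cmod_triangle ((f w - f z) * (g w - g z) + f z * (g w - g z)) ((f w - f z) * g z).
have t2 := Cmod_triangle ((f w - f z) * (g w - g z)) (f z * (g w - g z)).
rewrite !Cmod_mult -/A -/B in t1 t2.
have p1 := Cmod_ge_0 (f w - f z); have p2 := Cmod_ge_0 (g w - g z).
nra.
Qed.

Lemma cont_at_conj n (f : Cn n -> C) z : cont_at f z -> cont_at (fun w => Cconj (f w)) z.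
Proof.
move=> hf e /hf [d [d0 hd]]; exists d; split=> // w /hd.
by rewrite -Cminus_conj Cmod_conj.
Qed.

Lemma cont_at_coord n j (z : Cn n) : cont_at (fun w => w j) z.
Proof. by move=> e e0; exists e; split=> // w; apply. Qed.

Lemma cont_at_lin n a b (f g : Cn n -> C) z : cont_at f z -> cont_at g z ->
  cont_at (fun w => a * f w + b * g w)%C z.
Proof.
by move=> hf hg; apply: cont_at_plus; apply: cont_at_mult => //; apply: cont_at_const.
Qed.

Lemma cont_at_ext n (f g : Cn n -> C) z :
  (exists r, 0 < r /\ forall w, near_pt z w r -> f w = g w) -> cont_at f z -> cont_at g z.
Proof.
move=> [r [r0 hr]] hf e /hf [d [d0 hd]].
have m0 : 0 < Rmin r d by apply: Rmin_case.
exists (Rmin r d); split=> // w hw.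
rewrite -!hr; first by apply: hd; apply: near_pt_le hw; apply: Rmin_r.
  exact: near_pt_refl.
by apply: near_pt_le hw; apply: Rmin_l.
Qed.

(** Indexing by [dir] merges the two clauses for [dx] and [dy] into one over all real directions,
    the form used in every induction on [k]. *)
Lemma Ck_onS n k U (f : Cn n -> C) : Ck_on k.+1 U f <->
  (forall z, U z -> cont_at f z) /\
  forall d, (forall z, U z -> partial_at d f z) /\ Ck_on k U (pd d f).
Proof.
split=> -[h1 h2]; split=> //.
- move=> [j b]; have [p [c1 c2]] := h2 j; split; last by case: b.
  by move=> z /p /partials_existE; apply.
- move=> j; split; last by split; [apply: (h2 (j, false)).2 | apply: (h2 (j, true)).2].
  by move=> z hz; apply/partials_existE => b; apply: (h2 (j, b)).1.
Qed.

Lemma Ck_on_sub n k (U V : Cn n -> Prop) f : (forall z, V z -> U z) -> Ck_on k U f -> Ck_on k V f.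
Proof.
move=> s; elim: k f => [|k ih] f; first by move=> h z /s; apply: h.
move=> /Ck_onS [h1 h2]; apply/Ck_onS; split; first by move=> z /s; apply: h1.
by move=> d; have [p c] := h2 d; split; [move=> z /s; apply: p | apply: ih].
Qed.

(** Openness matters: a partial derivative at [z] sees values of the function around [z]. *)
Lemma Ck_on_ext n k (U : Cn n -> Prop) f g : openC U -> (forall z, U z -> f z = g z) ->
  Ck_on k U f -> Ck_on k U g.
Proof.
move=> oU.
have loc (f1 g1 : Cn n -> C) z : (forall z, U z -> f1 z = g1 z) -> U z ->
    exists r, 0 < r /\ forall w, near_pt z w r -> f1 w = g1 w.
  by move=> E /oU [r [r0 hr]]; exists r; split=> // w /hr; apply: E.
elim: k f g => [|k ih] f g E.
  by move=> h z Uz; apply: cont_at_ext (h z Uz); apply: loc.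
move=> /Ck_onS [h1 h2]; apply/Ck_onS; split.
  by move=> z Uz; apply: cont_at_ext (h1 z Uz); apply: loc.
move=> d; have [p c] := h2 d; split.
  by move=> z Uz; apply: partial_at_ext (p z Uz); apply: loc.
by apply: ih c => z Uz; apply: pd_ext; apply: loc.
Qed.

Lemma Ck_on_lin n k (U : Cn n -> Prop) a b f g : openC U ->
  Ck_on k U f -> Ck_on k U g -> Ck_on k U (fun w => a * f w + b * g w)%C.
Proof.
move=> oU; elim: k f g => [|k ih] f g.
  by move=> hf hg z Uz; apply: cont_at_lin; [apply: hf | apply: hg].
move=> /Ck_onS [f1 f2] /Ck_onS [g1 g2]; apply/Ck_onS; split.
  by move=> z Uz; apply: cont_at_lin; [apply: f1 | apply: g1].
move=> d; have [pf cf] := f2 d; have [pg cg] := g2 d; split.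
  by move=> z Uz; apply: partial_at_lin; [apply: pf | apply: pg].
apply: Ck_on_ext (ih _ _ cf cg) => // z Uz.
by rewrite pd_lin //; [apply: pf | apply: pg].
Qed.

(** * Smooth germs at the origin *)

Definition smooth (n : nat) (f : Cn n -> C) : Prop :=
  forall k, exists r, 0 < r /\ Ck_on k (box r) f.

Lemma smoothE n (f : Cn n -> C) : Cinf_at0 f <-> smooth f.
Proof.
split=> H k; have [U] := H k.
- move=> [oU [U0 c]]; have [r [r0 hr]] := oU _ U0.
  by exists r; split=> //; apply: Ck_on_sub c => z /near_origin; apply: hr.
- move=> [U0 c]; exists (box U); split; first exact: openC_box.
  by split=> //; apply: box_origin.
Qed.

Lemma smooth_D n d (f : Cn n -> C) : smooth f -> smooth (pd d f).
Proof.
move=> H k; have [r [r0 /Ck_onS [_ c]]] := H k.+1.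
by exists r; split=> //; apply: (c d).2.
Qed.

Lemma smooth_lin n a b (f g : Cn n -> C) : smooth f -> smooth g ->
  smooth (fun w => a * f w + b * g w)%C.
Proof.
move=> hf hg k; have [r [r0 c]] := hf k; have [s [s0 c']] := hg k.
exists (Rmin r s); split; first exact: Rmin_case.
apply: Ck_on_lin; first exact: openC_box.
- by apply: Ck_on_sub c => z; apply: box_le; apply: Rmin_l.
- by apply: Ck_on_sub c' => z; apply: box_le; apply: Rmin_r.
Qed.

Definition germ_eq (n : nat) (f g : Cn n -> C) : Prop :=
  exists r, 0 < r /\ forall w, box r w -> f w = g w.

Lemma germ_refl n (f : Cn n -> C) : germ_eq f f.
Proof. by exists 1; split; [lra|]. Qed.

Lemma germ_sym n (f g : Cn n -> C) : germ_eq f g -> germ_eq g f.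
Proof. by move=> [r [r0 h]]; exists r; split=> // w /h. Qed.

Lemma germ_trans n (f g h : Cn n -> C) : germ_eq f g -> germ_eq g h -> germ_eq f h.
Proof.
move=> [r [r0 hr]] [s [s0 hs]]; exists (Rmin r s); split; first exact: Rmin_case.
move=> w hw; rewrite hr ?hs //; apply: box_le hw; [exact: Rmin_r | exact: Rmin_l].
Qed.

Lemma germ_lin n a b (f f' g g' : Cn n -> C) : germ_eq f f' -> germ_eq g g' ->
  germ_eq (fun w => a * f w + b * g w)%C (fun w => a * f' w + b * g' w)%C.
Proof.
move=> [r [r0 hr]] [s [s0 hs]]; exists (Rmin r s); split; first exact: Rmin_case.
move=> w hw; rewrite hr ?hs //; apply: box_le hw; [exact: Rmin_r | exact: Rmin_l].
Qed.

Lemma germ_at0 n (f g : Cn n -> C) : germ_eq f g -> f (@origin n) = g (@origin n).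
Proof. by move=> [r [r0 h]]; apply: h; apply: box_origin. Qed.

Lemma germ_D n d (f g : Cn n -> C) : germ_eq f g -> germ_eq (pd d f) (pd d g).
Proof.
move=> [r [r0 h]]; exists r; split=> // w /openC_box [s [s0 hs]].
by apply: pd_ext; exists s; split=> // v /hs; apply: h.
Qed.

Lemma germ_D_lin n d a b (f g : Cn n -> C) : smooth f -> smooth g ->
  germ_eq (pd d (fun w => a * f w + b * g w)%C) (fun w => a * pd d f w + b * pd d g w)%C.
Proof.
move=> hf hg; have [r [r0 /Ck_onS [_ c]]] := hf 1%N; have [s [s0 /Ck_onS [_ c']]] := hg 1%N.
exists (Rmin r s); split; first exact: Rmin_case.
move=> w hw; apply: pd_lin; [apply: (c d).1 | apply: (c' d).1]; apply: box_le hw.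
  exact: Rmin_l.
exact: Rmin_r.
Qed.

(** * Wirtinger derivatives commute *)

(** No differentiability is required: [Derive] is the limit of the same difference quotients on both
    sides. *)
Lemma Derive_translate (f : R -> R) x : Derive (fun s => f (x + s)) 0 = Derive f x.
Proof.
rewrite /Derive; congr real; apply: Lim_ext => h.
by rewrite Rplus_0_l Rplus_0_r.
Qed.

(** Schwarz's theorem for the real function [G u v] of two displacements. The abstract [p] stands
    for [Re] or [Im], and the first four hypotheses are what the argument uses of them. *)
Lemma pd_comm_component (p : C -> R) n (d e : dir n) f z :
  (forall a b, p a - p b = p (a - b)%C) -> (forall c, Rabs (p c) <= Cmod c) ->
  (forall (g : R -> C) x l, isd g x l -> is_derive (fun s => p (g s)) x (p l)) ->
  (forall (d : dir n) f z, p (pd d f z) = Derive (fun s => p (f (move z d s))) 0) ->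
  (exists U, openC U /\ U z /\ Ck_on 2 U f) ->
  p (pd d (pd e f) z) = p (pd e (pd d f) z).
Proof.
move=> pB ple pis pD [U [oU [Uz /Ck_onS [_ C2]]]].
have [r [r0 hr]] := oU z Uz.
(* Half the radius for each move, since [d] and [e] may displace the same coordinate. *)
have inU u v : Rabs (u - 0) < r / 2 -> Rabs (v - 0) < r / 2 -> U (move (move z d u) e v).
  rewrite !Rminus_0_r => hu hv; apply: hr.
  have -> : r = r / 2 + r / 2 by field.
  exact: near_pt_trans (near_move _ _ hu) (near_move _ _ hv).
have pDm (d' : dir n) f' z' s : Derive (fun t => p (f' (move z' d' t))) s = p (pd d' f' (move z' d' s)).
  rewrite pD -Derive_translate; apply: Derive_ext => t; by rewrite move_move.
pose G u v := p (f (move (move z d u) e v)).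
have G2 u v : Derive (fun t => G u t) v = p (pd e f (move (move z d u) e v)) by apply: pDm.
have G1 u v : Derive (fun t => G t v) u = p (pd d f (move (move z d u) e v)).
  rewrite moveC -pDm; apply: Derive_ext => t; by rewrite /G moveC.
have G12 u v : Derive (fun s => Derive (fun t => G s t) v) u = p (pd d (pd e f) (move (move z d u) e v)).
  rewrite moveC -pDm; apply: Derive_ext => t; by rewrite G2 moveC.
have G21 u v : Derive (fun s => Derive (fun t => G t s) u) v = p (pd e (pd d f) (move (move z d u) e v)).
  rewrite -pDm; apply: Derive_ext => t; by rewrite G1.
have exd (d' : dir n) f' z' s : partial_at d' f' (move z' d' s) ->
    ex_derive (fun t => p (f' (move z' d' t))) s.
  by move=> h; eexists; apply: pis (pd_isd_at h).
have C1f := C2 d; have C1e := C2 e.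
move: C1f.2 C1e.2 => /Ck_onS [_ Cd] /Ck_onS [_ Ce].
have cont (g : Cn n -> C) : (forall w, U w -> cont_at g w) ->
    continuity_2d_pt (fun u v => p (g (move (move z d u) e v))) 0 0.
  move=> hg eps; have [s [s0 hs]] := hg z Uz _ (cond_pos eps).
  have s2 : 0 < s / 2 by lra.
  exists (mkposreal _ s2) => u v /= hu hv; rewrite !move0 pB.
  apply: Rle_lt_trans (ple _) _; apply: hs.
  have -> : s = s / 2 + s / 2 by field.
  by rewrite !Rminus_0_r in hu hv; apply: near_pt_trans (near_move _ _ hu) (near_move _ _ hv).
have S : Derive (fun s => Derive (fun t => G s t) 0) 0 = Derive (fun s => Derive (fun t => G t s) 0) 0.
  apply: Schwarz.
  - have r2 : 0 < r / 2 by lra.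
    exists (mkposreal _ r2) => u v /= hu hv; have Uuv := inU _ _ hu hv.
    split; [|split; [|split]].
    + apply: ex_derive_ext; first by move=> t; rewrite /G moveC.
      by apply: exd; rewrite moveC; apply: C1f.1.
    + by apply: exd; apply: C1e.1.
    + apply: ex_derive_ext; first by move=> t; rewrite G2 moveC.
      by apply: exd; rewrite moveC; apply: (Ce d).1.
    + apply: ex_derive_ext; first by move=> t; rewrite G1.
      by apply: exd; apply: (Cd e).1.
  - apply: continuity_2d_pt_ext; first by move=> u v; rewrite G12.
    by apply: cont => w Uw; apply: ((Ce d).2).
  - apply: continuity_2d_pt_ext; first by move=> u v; rewrite G21.
    by apply: cont => w Uw; apply: ((Cd e).2).
by move: S; rewrite G12 G21 !move0.
Qed.

Lemma germ_D_comm n (d e : dir n) f : smooth f -> germ_eq (pd d (pd e f)) (pd e (pd d f)).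
Proof.
move=> H; have [r [r0 c]] := H 2%N; exists r; split=> // z hz.
have op : exists U, openC U /\ U z /\ Ck_on 2 U f.
  by exists (box r); split; [exact: openC_box|].
have hre := @pd_comm_component Re n d e f z.
have him := @pd_comm_component Im n d e f z.
have {}hre : Re (pd d (pd e f) z) = Re (pd e (pd d f) z).
  apply: hre op => //; first exact: re_le_Cmod.
  - by move=> g x l [].
  - by move=> ? ? ?; rewrite pd_E.
have {}him : Im (pd d (pd e f) z) = Im (pd e (pd d f) z).
  apply: him op => //; first exact: im_le_Cmod.
  - by move=> g x l [].
  - by move=> ? ? ?; rewrite pd_E.
by case: (pd d _ z) (pd e _ z) hre him => [? ?] [? ?] /= -> ->.
Qed.

Definition W (n : nat) (d : dir n) (f : Cn n -> C) : Cn n -> C :=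
  if d.2 then dzb d.1 f else dz d.1 f.

(** The coefficient of [dy] in [dzb] or [dz]; it puts both Wirtinger derivatives into the shape a f
    + b g of the linearity lemmas. *)
Definition wirt (b : bool) : C := (RtoC (/ 2) * (if b then Ci else - Ci))%C.

Lemma WE n (d : dir n) f :
  W d f = fun z => (RtoC (/ 2) * pd (d.1, false) f z + wirt d.2 * pd (d.1, true) f z)%C.
Proof.
by apply: functional_extensionality => z; case: d => j []; rewrite /W /dzb /dz /wirt /pd /=; ring.
Qed.

Lemma smooth_W n (d : dir n) f : smooth f -> smooth (W d f).
Proof. by move=> h; rewrite WE; apply: smooth_lin; apply: smooth_D. Qed.

Lemma germ_W n (d : dir n) f g : germ_eq f g -> germ_eq (W d f) (W d g).
Proof. by move=> h; rewrite !WE; apply: germ_lin; apply: germ_D. Qed.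

Lemma germ_ext n (f g : Cn n -> C) : (forall z, f z = g z) -> germ_eq f g.
Proof. by move=> h; exists 1; split; [lra|]. Qed.

Lemma germ_W_lin n (d : dir n) a b f g : smooth f -> smooth g ->
  germ_eq (W d (fun w => a * f w + b * g w)%C) (fun w => a * W d f w + b * W d g w)%C.
Proof.
move=> hf hg; rewrite !WE.
apply: germ_trans (germ_lin _ _ (germ_D_lin _ a b hf hg) (germ_D_lin _ a b hf hg)) _.
by apply: germ_ext => z; ring.
Qed.

Lemma germ_W_comm n (d e : dir n) f : smooth f -> germ_eq (W d (W e f)) (W e (W d f)).
Proof.
move=> hf.
have expand (d' e' : dir n) : germ_eq (W d' (W e' f)) (fun z =>
    RtoC (/ 2) * (RtoC (/ 2) * pd (d'.1, false) (pd (e'.1, false) f) z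
                  + wirt e'.2 * pd (d'.1, false) (pd (e'.1, true) f) z)
  + wirt d'.2 * (RtoC (/ 2) * pd (d'.1, true) (pd (e'.1, false) f) z
                  + wirt e'.2 * pd (d'.1, true) (pd (e'.1, true) f) z))%C.
  by rewrite [W d' _]WE [W e' _]WE; apply: germ_lin; apply: germ_D_lin; apply: smooth_D.
apply: germ_trans (expand d e) _; apply: germ_trans (germ_sym (expand e d)).
apply: germ_trans.
  by apply: germ_lin; apply: germ_lin; apply: germ_D_comm.
by apply: germ_ext => z; ring.
Qed.

(** * Words of Wirtinger derivatives *)

Definition foldW (n : nat) (w : seq (dir n)) (f : Cn n -> C) : Cn n -> C := foldr (@W n) f w.

Lemma foldW_cat n (w v : seq (dir n)) f : foldW (w ++ v) f = foldW w (foldW v f).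
Proof. exact: foldr_cat. Qed.

Lemma smooth_foldW n (w : seq (dir n)) f : smooth f -> smooth (foldW w f).
Proof. by move=> h; elim: w => //= d w; apply: smooth_W. Qed.

Lemma germ_foldW_lin n (w : seq (dir n)) a b f g : smooth f -> smooth g ->
  germ_eq (foldW w (fun w => a * f w + b * g w)%C) (fun z => a * foldW w f z + b * foldW w g z)%C.
Proof.
move=> hf hg; elim: w => [|d w ih] /=; first exact: germ_refl.
apply: germ_trans (germ_W d ih) _.
by apply: germ_W_lin; apply: smooth_foldW.
Qed.

Lemma germ_foldW_cons n (w v : seq (dir n)) d f : smooth f ->
  germ_eq (foldW (w ++ d :: v) f) (foldW (d :: w ++ v) f).
Proof.
move=> hf; elim: w => [|e w ih] /=; first exact: germ_refl.
apply: germ_trans (germ_W e ih) _ => /=.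
by apply: germ_W_comm; apply: smooth_foldW.
Qed.

(** The head of [w] occurs somewhere in [v] and is commuted to the front there. Hence a derivative
    depends only on the number of occurrences of each letter, and any word may be put in the order
    fixed by [Dkm]. *)
Lemma germ_foldW_perm n (w v : seq (dir n)) f : smooth f -> perm_eq w v ->
  germ_eq (foldW w f) (foldW v f).
Proof.
move=> hf; elim: w v => [|d w ih] v pe.
  by have /nilP -> : nilp v; [rewrite /nilp -(perm_size pe) | exact: germ_refl].
have dv : d \in v by rewrite -(perm_mem pe) inE eqxx.
case/splitPr: v / dv pe => v1 v2 pe.
apply: germ_trans (germ_sym (germ_foldW_cons v1 v2 d hf)) => /=.
apply: germ_W; apply: ih.
by rewrite -(perm_cons d); apply: perm_trans pe _; rewrite -cat1s perm_catCA.
Qed.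

Lemma foldW_nseq n p (d : dir n) f : foldW (nseq p d) f = Nat.iter p (W d) f.
Proof. by elim: p => //= p ->. Qed.

(* The ordering of [Dkm]: holomorphic derivatives outside, each block in the order of [enum]. *)
Definition block (n : nat) (k : 'I_n -> nat) (b : bool) (l : seq 'I_n) : seq (dir n) :=
  flatten [seq nseq (k j) (j, b) | j <- l].

Lemma foldW_block n (k : 'I_n -> nat) b l f :
  foldW (block k b l) f = List.fold_right (fun j g => Nat.iter (k j) (W (j, b)) g) f l.
Proof. by elim: l => //= j l ih; rewrite /block /= foldW_cat -/(block k b l) ih foldW_nseq. Qed.

Lemma DkmE n (k m : 'I_n -> nat) f :
  Dkm k m f = foldW (block k false (enum 'I_n) ++ block m true (enum 'I_n)) f.
Proof. by rewrite foldW_cat !foldW_block. Qed.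

Lemma count_block n (k : 'I_n -> nat) b l (d : dir n) : uniq l ->
  count_mem d (block k b l) = if (d.2 == b) && (d.1 \in l) then k d.1 else 0%N.
Proof.
elim: l => [|j l ih] /=; first by rewrite andbF.
move=> /andP [jl /ih]; rewrite /block /= count_cat count_nseq /= => ->.
rewrite inE; case: d {ih} => i c /=; rewrite xpair_eqE [j == i]eq_sym [b == c]eq_sym.
case: (c == b); rewrite ?andbF //= andbT.
case: eqP => [->|_] /=; last by rewrite mul0n.
by rewrite (negbTE jl) mul1n addn0.
Qed.

(** * Polynomials in [z] and [conj z] *)

Lemma Cconj_RtoC (x : R) : Cconj (RtoC x) = RtoC x.
Proof. by rewrite /Cconj /RtoC /=; f_equal; ring. Qed.

Lemma RtoC_neq0 (x : R) : x <> 0 -> RtoC x <> RtoC 0.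
Proof. by move=> h /RtoC_inj. Qed.

Definition lsum (A : Type) (g : A -> C) (l : seq A) : C :=
  List.fold_right (fun x acc => Cplus (g x) acc) (RtoC 0) l.

Lemma lsum_cat A (g : A -> C) l m : lsum g (l ++ m) = (lsum g l + lsum g m)%C.
Proof. by elim: l => /= [|x l ->]; ring. Qed.

Lemma lsum_map A B (g : B -> C) (h : A -> B) l : lsum g (map h l) = lsum (fun x => g (h x)) l.
Proof. by elim: l => //= x l ->. Qed.

Lemma eq_lsum A (g h : A -> C) l : (forall x, g x = h x) -> lsum g l = lsum h l.
Proof. by move=> e; elim: l => //= x l ->; rewrite e. Qed.

Lemma lsum_scal A c (g : A -> C) l : lsum (fun x => c * g x)%C l = (c * lsum g l)%C.
Proof. by elim: l => /= [|x l ->]; ring. Qed.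

Lemma lsum_filter A (P : pred A) (g : A -> C) l :
  lsum g l = (lsum g (filter P l) + lsum g (filter (predC P) l))%C.
Proof. by elim: l => /= [|x l ->]; [ring|]; case: (P x) => /=; ring. Qed.

Lemma lsum_single (A : eqType) (g : A -> C) l x : uniq l -> x \in l ->
  (forall y, y != x -> g y = RtoC 0) -> lsum g l = g x.
Proof.
move=> ul xl gz; elim: l ul xl => //= y l ih /andP [yl ul]; rewrite inE.
have zero : x \notin l -> lsum g l = RtoC 0.
  elim: (l) => //= u v iv; rewrite inE negb_or => /andP [ux xv].
  by rewrite iv // gz; [ring | rewrite eq_sym].
case: eqP => [e _|/eqP xy /= xl]; first by rewrite zero ?e //; ring.
by rewrite ih // gz; [ring | rewrite eq_sym].
Qed.

(** One function holds a whole pair of multi-indices: the value at [(j, false)] is the exponent of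
    z_j, the value at [(j, true)] that of its conjugate. Exponents and letter counts of words thus
    have the same type. *)
Notation expo n := (dir n -> nat).

Definition mono (n : nat) (X : expo n) (z : Cn n) : C :=
  monomial (fun j => X (j, false)) (fun j => X (j, true)) z.

Definition evalp (n : nat) (s : seq (C * expo n)) (z : Cn n) : C :=
  lsum (fun tm => tm.1 * mono tm.2 z)%C s.

Definition join (n : nat) (k m : 'I_n -> nat) : expo n := fun d => if d.2 then m d.1 else k d.1.

Lemma is_poly_zzbarE n (q : Cn n -> C) :
  is_poly_zzbar q <-> exists s : seq (C * expo n), q = evalp s.
Proof.
split=> -[s hs].
- exists [seq (tm.1, join tm.2.1 tm.2.2) | tm <- s].
  by apply: functional_extensionality => z; rewrite hs /evalp lsum_map.
- exists [seq (tm.1, (fun j => tm.2 (j, false), fun j => tm.2 (j, true))) | tm <- s] => z.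
  by rewrite hs -[RHS]/(lsum (fun tm => tm.1 * monomial tm.2.1 tm.2.2 z)%C _) lsum_map.
Qed.

Lemma cprod_ext n (g h : 'I_n -> C) : (forall j, g j = h j) -> cprod g = cprod h.
Proof. by move=> e; rewrite /cprod; elim: (enum 'I_n) => //= j l ->; rewrite e. Qed.

Lemma cprod_mul n (g h : 'I_n -> C) : cprod (fun j => g j * h j)%C = (cprod g * cprod h)%C.
Proof. by rewrite /cprod; elim: (enum 'I_n) => /= [|j l ->]; ring. Qed.

Lemma cprod_single n (j : 'I_n) c : cprod (fun i => if i == j then c else RtoC 1) = c.
Proof.
rewrite /cprod; have : j \in enum 'I_n by rewrite mem_enum.
have none (l : seq 'I_n) : j \notin l ->
    List.fold_right (fun i acc => (if i == j then c else RtoC 1) * acc)%C (RtoC 1) l = RtoC 1.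
  elim: l => //= i l ih; rewrite inE negb_or eq_sym => /andP [/negbTE -> /ih ->]; ring.
elim: (enum 'I_n) (enum_uniq 'I_n) => //= i l ih /andP [il ul]; rewrite inE eq_sym.
case: eqP => [e _|_ /= jl]; last by rewrite ih //; ring.
by rewrite none -?e //; ring.
Qed.

Lemma cpow1 k : cpow (RtoC 1) k = RtoC 1.
Proof. by elim: k => //= k ->; ring. Qed.

Lemma cpow_add c k m : cpow c (k + m) = (cpow c k * cpow c m)%C.
Proof.
elim: k => [|k ih]; first by rewrite add0n /=; ring.
by rewrite addSn -[LHS]/(c * cpow c (k + m)%N)%C ih -[cpow c k.+1]/(c * cpow c k)%C; ring.
Qed.

Lemma cpow_mul c d k : cpow (c * d)%C k = (cpow c k * cpow d k)%C.
Proof. by elim: k => /= [|k ->]; ring. Qed.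

Definition off (n : nat) (j : 'I_n) (X : expo n) : expo n := fun d => if d.1 == j then 0%N else X d.

(** The predecessor of 0 is 0, which is harmless: [down] always comes with the old exponent as a
    factor. *)
Definition down (n : nat) (d : dir n) (X : expo n) : expo n :=
  fun e => if e == d then (X e).-1 else X e.

Lemma mono_off n (X : expo n) j z : mono X z =
  (cpow (z j) (X (j, false)) * cpow (Cconj (z j)) (X (j, true)) * mono (off j X) z)%C.
Proof.
rewrite /mono /monomial.
rewrite -[(cpow (z j) (X (j, false)) * _)%C](cprod_single j) -cprod_mul.
apply: cprod_ext => i; rewrite /off /=; case: eqP => [->|_] /=; ring.
Qed.

Lemma mono_off_shift n (X : expo n) j z c : mono (off j X) (shift z j c) = mono (off j X) z.
Proof. by apply: cprod_ext => i; rewrite /off /shift /=; case: eqP. Qed.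

Lemma off_down n (X : expo n) j b : off j (down (j, b) X) = off j X.
Proof.
apply: functional_extensionality => -[i c]; rewrite /off /down /= xpair_eqE.
by case: eqP.
Qed.

(** After splitting off the powers of z_j and its conjugate, the remaining factor is constant along
    the move, and the product rule applies to two powers. *)
Lemma isd_mono n (X : expo n) j e z : isd (fun s => mono X (move z (j, e) s)) 0
  (RtoC (INR (X (j, false))) * unit_of e * mono (down (j, false) X) z
   + RtoC (INR (X (j, true))) * Cconj (unit_of e) * mono (down (j, true) X) z)%C.
Proof.
have hz : isd (fun s => z j + unit_of e * RtoC s)%C 0 (unit_of e).
  apply: isd_val (isd_plus (isd_const _ _) (isd_id _ _)) _; ring.
have h := isd_mult (isd_mult (isd_pow (X (j, false)) hz) (isd_pow (X (j, true)) (isd_conj hz)))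
   (isd_const (mono (off j X) z) 0).
apply: isd_ext (isd_val h _).
- by move=> s; rewrite [RHS](mono_off _ j) /move mono_off_shift /shift eqxx //.
- rewrite Cmult_0_r Cplus_0_r [mono (down (j, false) X) z](mono_off _ j).
  rewrite [mono (down (j, true) X) z](mono_off _ j) !off_down /down !xpair_eqE !eqxx /=; ring.
Qed.

Definition der (n : nat) (d : dir n) (s : seq (C * expo n)) : seq (C * expo n) :=
  flatten [seq [:: (tm.1 * RtoC (INR (tm.2 (d.1, false))) * unit_of d.2, down (d.1, false) tm.2)%C;
     (tm.1 * RtoC (INR (tm.2 (d.1, true))) * Cconj (unit_of d.2), down (d.1, true) tm.2)%C] | tm <- s].

Lemma evalp_cons n tm (s : seq (C * expo n)) z :
  evalp (tm :: s) z = (tm.1 * mono tm.2 z + evalp s z)%C.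
Proof. by []. Qed.

Lemma isd_evalp n (s : seq (C * expo n)) d z :
  isd (fun t => evalp s (move z d t)) 0 (evalp (der d s) z).
Proof.
elim: s => [|tm s ih]; first exact: isd_const.
case: d ih => j e ih.
apply: isd_val (isd_plus (isd_scal tm.1 (isd_mono tm.2 j e z)) ih) _.
rewrite -[evalp (der _ (tm :: s)) z]/(_ * _ + (_ * _ + evalp (der (j, e) s) z))%C /=; ring.
Qed.

Lemma pd_evalp n (s : seq (C * expo n)) d : pd d (evalp s) = evalp (der d s).
Proof. by apply: functional_extensionality => z; apply: isd_D; apply: isd_evalp. Qed.

Lemma cont_at_pow n (f : Cn n -> C) z k : cont_at f z -> cont_at (fun w => cpow (f w) k) z.
Proof.
move=> hf; elim: k => [|k ih]; first exact: cont_at_const.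
exact: cont_at_mult.
Qed.

Lemma cont_at_mono n (X : expo n) z : cont_at (mono X) z.
Proof.
rewrite /mono /monomial /cprod; elim: (enum 'I_n) => [|j l ih]; first exact: cont_at_const.
apply: cont_at_mult ih; apply: cont_at_mult; apply: cont_at_pow; last apply: cont_at_conj;
  exact: cont_at_coord.
Qed.

Lemma cont_at_evalp n (s : seq (C * expo n)) z : cont_at (evalp s) z.
Proof.
elim: s => [|tm s ih]; first exact: cont_at_const.
apply: cont_at_plus ih; apply: cont_at_mult; [exact: cont_at_const | exact: cont_at_mono].
Qed.

Lemma Ck_on_evalp n k U (s : seq (C * expo n)) : Ck_on k U (evalp s).
Proof.
elim: k s => [|k ih] s; first by move=> z _; apply: cont_at_evalp.
apply/Ck_onS; split; first by move=> z _; apply: cont_at_evalp.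
move=> d; split; last by rewrite pd_evalp.
by move=> z _; eexists; apply: isd_evalp.
Qed.

Lemma smooth_evalp n (s : seq (C * expo n)) : smooth (evalp s).
Proof. by move=> k; exists 1; split; [lra | apply: Ck_on_evalp]. Qed.

Lemma smooth_mono n (X : expo n) : smooth (mono X).
Proof.
have -> : mono X = evalp [:: (RtoC 1, X)].
  by apply: functional_extensionality => z; rewrite /evalp /=; ring.
exact: smooth_evalp.
Qed.

(** Wirtinger derivatives treat z_j and its conjugate as independent variables: the unwanted term
    carries the factor 1 + i^2. *)
Lemma W_scal_mono n (d : dir n) c (X : expo n) : W d (fun z => c * mono X z)%C =
  (fun z => c * RtoC (INR (X d)) * mono (down d X) z)%C.
Proof.
have E : (fun z => c * mono X z)%C = evalp [:: (c, X)].
  by apply: functional_extensionality => z; rewrite /evalp /=; ring.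
rewrite WE E !pd_evalp; apply: functional_extensionality => z.
rewrite /evalp /der /wirt /= !Cconj_RtoC.
have ci : Cconj Ci = (- Ci)%C by rewrite /Cconj /Ci /Copp /=; f_equal; ring.
have h2 : RtoC (/ 2) = (/ RtoC 2)%C by rewrite RtoC_inv.
rewrite ci; case: d E => j [] _ /=; set m1 := mono _ z; set m2 := mono _ z.
- transitivity (/ RtoC 2 * (c * RtoC (INR (X (j, false))) * m1 * (RtoC 1 + Ci * Ci)
    + c * RtoC (INR (X (j, true))) * m2 * (RtoC 1 - Ci * Ci)))%C.
    by rewrite h2; ring.
  by rewrite Ci_sqr; field.
- transitivity (/ RtoC 2 * (c * RtoC (INR (X (j, false))) * m1 * (RtoC 1 - Ci * Ci)
    + c * RtoC (INR (X (j, true))) * m2 * (RtoC 1 + Ci * Ci)))%C.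
    by rewrite h2; ring.
  by rewrite Ci_sqr; field.
Qed.

(** A product of falling factorials: reading [w] from the right, the occurrence of [d] preceded by i
    others contributes [X d - i], truncated at 0. *)
Fixpoint ffall (n : nat) (w : seq (dir n)) (X : expo n) : nat :=
  if w is d :: w' then (ffall w' X * (X d - count_mem d w'))%N else 1%N.

Lemma foldW_mono n (w : seq (dir n)) (X : expo n) : foldW w (mono X) =
  (fun z => RtoC (INR (ffall w X)) * mono (fun d => X d - count_mem d w)%N z)%C.
Proof.
elim: w => [|d w ih] /=.
  apply: functional_extensionality => z; rewrite Cmult_1_l; congr mono.
  by apply: functional_extensionality => d; rewrite subn0.
rewrite ih W_scal_mono; apply: functional_extensionality => z.
rewrite -RtoC_mult -mult_INR multE; congr (_ * mono _ _)%C.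
apply: functional_extensionality => e; rewrite /down [d == e]eq_sym.
by case: eqP => _ /=; rewrite ?add0n // add1n subnS.
Qed.

Lemma mono_origin n (X : expo n) :
  mono X (@origin n) = if [forall d : 'I_n * bool, X d == 0%N] then RtoC 1 else RtoC 0.
Proof.
have pz k : k != 0%N -> cpow (RtoC 0) k = RtoC 0 by case: k => //= k _; ring.
case: ifP => [/forallP H|/negbT].
  rewrite /mono /monomial -[RHS](_ : cprod (fun _ : 'I_n => RtoC 1) = RtoC 1); last first.
    by rewrite /cprod; elim: (enum _) => //= i l ->; ring.
  by apply: cprod_ext => j; rewrite (eqP (H (j, false))) (eqP (H (j, true))) /=; ring.
rewrite negb_forall => /existsP [[j b] h]; rewrite (mono_off _ j).
have -> : Cconj (origin j) = RtoC 0 by rewrite Cconj_RtoC.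
by case: b h => h; [rewrite [cpow _ (X (j, true))]pz | rewrite [cpow _ (X (j, false))]pz] => //; ring.
Qed.

Lemma ffall_eq0 n (w : seq (dir n)) (X : expo n) d : (X d < count_mem d w)%N -> ffall w X = 0%N.
Proof.
elim: w => //= e w ih; case: (ltnP (X d) (count_mem d w)) => [/ih -> //|le].
case: eqP => [->|_] /=; last by rewrite add0n ltnNge le.
rewrite add1n ltnS => le'; apply/eqP; rewrite muln_eq0; apply/orP; right.
by rewrite subn_eq0.
Qed.

Lemma ffall_gt0 n (w : seq (dir n)) (X : expo n) :
  (forall d, count_mem d w <= X d)%N -> (0 < ffall w X)%N.
Proof.
elim: w => //= e w ih H; rewrite muln_gt0 subn_gt0; apply/andP; split.
  by apply: ih => d; apply: leq_trans (H d); apply: leq_addl.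
by have := H e; rewrite eqxx.
Qed.

(** Derivatives at the origin are dual to monomials. A letter used too often makes [ffall] vanish,
    and one used too rarely leaves a positive power, which vanishes at the origin. *)
Lemma foldW_mono_origin n (w : seq (dir n)) (X : expo n) : foldW w (mono X) (@origin n) =
  if [forall d : 'I_n * bool, X d == count_mem d w] then RtoC (INR (ffall w X)) else RtoC 0.
Proof.
rewrite foldW_mono mono_origin; case: (boolP [forall d, X d == _]) => [/forallP H|].
  have -> : [forall d, (X d - count_mem d w)%N == 0%N].
    by apply/forallP => d; rewrite (eqP (H d)) subnn.
  by ring.
rewrite negb_forall => /existsP [d]; rewrite neq_ltn => /orP [lt|lt].
  by rewrite (ffall_eq0 lt) /=; ring.
have -> : [forall d, (X d - count_mem d w)%N == 0%N] = false.
  by apply/negbTE; rewrite negb_forall; apply/existsP; exists d; rewrite subn_eq0 -ltnNge.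
by ring.
Qed.

Lemma foldW_evalp_origin n (w : seq (dir n)) (s : seq (C * expo n)) :
  foldW w (evalp s) (@origin n) = lsum (fun tm => tm.1 * foldW w (mono tm.2) (@origin n))%C s.
Proof.
have zero : foldW w (evalp [::]) (@origin n) = RtoC 0.
  have h := germ_foldW_lin w (RtoC 0) (RtoC 0) (@smooth_evalp n [::]) (@smooth_evalp n [::]).
  have E : evalp [::] = (fun z : Cn n => RtoC 0 * evalp [::] z + RtoC 0 * evalp [::] z)%C.
    by apply: functional_extensionality => z; rewrite /evalp /=; ring.
  by rewrite {1}E (germ_at0 h); ring.
elim: s => [|tm s ih] //.
have E : evalp (tm :: s) = (fun z : Cn n => tm.1 * mono tm.2 z + RtoC 1 * evalp s z)%C.
  by apply: functional_extensionality => z; rewrite /evalp /=; ring.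
rewrite E (germ_at0 (germ_foldW_lin w _ _ (smooth_mono _) (smooth_evalp _))) ih /=; ring.
Qed.

(** * Taylor polynomials *)

(** Only coordinate [i] changes: move first in x_i, then in y_i, with cost [2 * K * h] for each
    segment. The intermediate corner may leave [box r], but the sum of its real and imaginary parts
    in absolute value stays below [2 * r], which is why the derivatives are bounded on the larger
    box. *)
Lemma coord_increment n r K h (f : Cn n -> C) (u v : Cn n) i :
  (forall z, box (2 * r) z -> forall d, partial_at d f z /\ Cmod (pd d f z) <= K) ->
  box r u -> box r v -> (forall j, j != i -> v j = u j) -> Cmod (v i - u i)%C <= h ->
  Cmod (f v - f u)%C <= 4 * K * h.
Proof.
move=> H bu bv E hh.
have r0 : 0 < r by apply: Rle_lt_trans (Cmod_ge_0 (u i)) (bu i).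
set s := Re (v i) - Re (u i); set t := Im (v i) - Im (u i).
have K0 : 0 <= K.
  have [|_ hK] := H u _ (i, false); first by apply: box_le bu; lra.
  exact: Rle_trans (Cmod_ge_0 _) hK.
have sh : Rabs s <= h by apply: Rle_trans (re_le_Cmod (v i - u i)%C) hh.
have th : Rabs t <= h by apply: Rle_trans (im_le_Cmod (v i - u i)%C) hh.
have bnd a b c : Rmin 0 (b - a) <= c <= Rmax 0 (b - a) -> Rabs a < r -> Rabs b < r -> Rabs (a + c) < r.
  move=> [c1 c2] /Rabs_def2 [a1 a2] /Rabs_def2 [b1 b2]; apply: Rabs_def1.
    by move: c2; rewrite /Rmax; case: Rle_dec => _ ?; lra.
  by move: c1; rewrite /Rmin; case: Rle_dec => _ ?; lra.
have reu := Rle_lt_trans _ _ _ (re_le_Cmod _) (bu i); have imu := Rle_lt_trans _ _ _ (im_le_Cmod _) (bu i).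
have rev := Rle_lt_trans _ _ _ (re_le_Cmod _) (bv i); have imv := Rle_lt_trans _ _ _ (im_le_Cmod _) (bv i).
set p := move u (i, false) s.
have pv : move p (i, true) t = v.
  apply: functional_extensionality => j; rewrite /p /move /shift /=.
  case: eqP => [->|/eqP ji]; last by rewrite E.
  by rewrite /s /t; case: (v i) (u i) => [a b] [c d]; rewrite /Ci /RtoC /Cplus /Cmult /=; f_equal; ring.
have b1 c : Rmin 0 s <= c <= Rmax 0 s -> box (2 * r) (move u (i, false) c).
  move=> hc j; rewrite /move /shift /=; case: eqP => [->|_]; last by have := bu j; lra.
  apply: Rle_lt_trans (Cmod_le_ReIm _) _.
  have -> : Re (u i + RtoC 1 * RtoC c)%C = Re (u i) + c by rewrite /Re /=; ring.
  have -> : Im (u i + RtoC 1 * RtoC c)%C = Im (u i) by rewrite /Im /=; ring.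
  by have := bnd _ _ _ hc reu rev; lra.
have b2 c : Rmin 0 t <= c <= Rmax 0 t -> box (2 * r) (move p (i, true) c).
  move=> hc j; rewrite /p /move /shift /=; case: eqP => [->|_]; last by have := bu j; lra.
  apply: Rle_lt_trans (Cmod_le_ReIm _) _.
  have -> : Re (u i + RtoC 1 * RtoC s + Ci * RtoC c)%C = Re (v i) by rewrite /s /Re /=; ring.
  have -> : Im (u i + RtoC 1 * RtoC s + Ci * RtoC c)%C = Im (u i) + c by rewrite /Im /=; ring.
  by have := bnd _ _ _ hc imu imv; lra.
have m1 := @mvt_Cmod (fun c => f (move u (i, false) c)) 0 s K.
have m2 := @mvt_Cmod (fun c => f (move p (i, true) c)) 0 t K.
rewrite !Rminus_0_r !move0 pv in m1 m2.
have {}m1 : Cmod (f p - f u)%C <= 2 * K * Rabs s.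
  apply: m1 => c /b1 /H /(_ (i, false)) [pa le].
  by exists (pd (i, false) f (move u (i, false) c)); split=> //; apply: pd_isd_at.
have {}m2 : Cmod (f v - f p)%C <= 2 * K * Rabs t.
  apply: m2 => c /b2 /H /(_ (i, true)) [pa le].
  by exists (pd (i, true) f (move p (i, true) c)); split=> //; apply: pd_isd_at.
have -> : (f v - f u = (f v - f p) + (f p - f u))%C by ring.
have tr := Cmod_triangle (f v - f p) (f p - f u).
nra.
Qed.

Lemma lipschitz_box n r K h (f : Cn n -> C) (u v : Cn n) : 0 <= h ->
  (forall z, box (2 * r) z -> forall d, partial_at d f z /\ Cmod (pd d f z) <= K) ->
  box r u -> box r v -> (forall j, Cmod (v j - u j)%C <= h) ->
  Cmod (f v - f u)%C <= 4 * INR n * K * h.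
Proof.
move=> h0 H bu bv hh.
(* The coordinates listed in [l] are already replaced by those of [v]; passing from [u] to [v] takes
   one step per coordinate. *)
pose mix (l : seq 'I_n) : Cn n := fun j => if j \in l then v j else u j.
have bmix l : box r (mix l) by move=> j; rewrite /mix; case: ifP.
suff S l : Cmod (f (mix l) - f u)%C <= 4 * INR (size l) * K * h.
  have := S (enum 'I_n); rewrite size_enum_ord.
  suff -> : mix (enum 'I_n) = v by [].
  by apply: functional_extensionality => j; rewrite /mix mem_enum.
elim: l => [|i l ih].
  have -> : mix [::] = u by apply: functional_extensionality.
  have -> : (f u - f u)%C = RtoC 0 by ring.
  by rewrite Cmod_0 /=; lra.
have step : Cmod (f (mix (i :: l)) - f (mix l))%C <= 4 * K * h.
  apply: (@coord_increment n r K h f _ _ i) => //.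
    by move=> j ji; rewrite /mix inE (negbTE ji).
  rewrite /mix inE eqxx /=; case: ifP => _ //.
  by have -> : (v i - v i)%C = RtoC 0; [ring | rewrite Cmod_0].
have -> : (f (mix (i :: l)) - f u = (f (mix (i :: l)) - f (mix l)) + (f (mix l) - f u))%C by ring.
apply: Rle_trans (Cmod_triangle _ _) _.
by rewrite [size _]/= S_INR; lra.
Qed.

(* The same small [rho] serves as validity radius and as inverse of the constant, so that
   finitely many bounds are merged by taking minima. *)
Definition order_bound (n N : nat) (f : Cn n -> C) (rho : R) : Prop :=
  forall r, 0 < r <= rho -> forall w, box r w -> Cmod (f w) <= r ^ N / rho.

Definition order_lipschitz (n N : nat) (f : Cn n -> C) (rho : R) : Prop :=
  forall r, 0 < r <= rho -> forall u v, box r u -> box r v ->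
  forall h, 0 <= h -> (forall j, Cmod (v j - u j)%C <= h) -> Cmod (f v - f u)%C <= r ^ N / rho * h.

Lemma inv_antimono (x a b : R) : 0 <= x -> 0 < a <= b -> x / b <= x / a.
Proof.
move=> x0 [a0 ab]; apply: Rmult_le_compat_l => //; apply: Rinv_le_contravar => //.
Qed.

Lemma order_bound_le n N (f : Cn n -> C) a b : 0 < a <= b -> order_bound N f b -> order_bound N f a.
Proof.
move=> ab H r hr w bw; apply: Rle_trans (H r _ w bw) _; first by lra.
by apply: inv_antimono ab; apply: pow_le; lra.
Qed.

(** The inverse of the Wirtinger change of basis, which turns bounds on [dz] and [dzb] into bounds
    on real partial derivatives. *)
Lemma pd_W n j b (f : Cn n -> C) z :
  pd (j, b) f z = if b then (Ci * (W (j, false) f z - W (j, true) f z))%C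
                  else (W (j, false) f z + W (j, true) f z)%C.
Proof.
have h2 : RtoC (/ 2) = (/ RtoC 2)%C by rewrite RtoC_inv.
have n2 : RtoC 2 <> RtoC 0 by apply: RtoC_neq0; lra.
rewrite !WE /wirt /=; case: b.
- transitivity (- (Ci * Ci) * (RtoC (/ 2) * RtoC 2) * pd (j, true) f z)%C; last by ring.
  by rewrite Ci_sqr h2; field.
- transitivity ((RtoC (/ 2) * RtoC 2) * pd (j, false) f z)%C; last by ring.
  by rewrite h2; field.
Qed.

Lemma order_lipschitz_of_W n N (f : Cn n -> C) : smooth f ->
  (forall d, exists rho, 0 < rho /\ order_bound N (W d f) rho) ->
  exists rho, 0 < rho /\ order_lipschitz N f rho.
Proof.
move=> sf H.
have [s [s0 /Ck_onS [_ c1]]] := sf 1%N.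
have [||rho [rho0 hr]] := @ord_uniform_pos n
  (fun j rho => forall b, order_bound N (W (j, b) f) rho).
- by move=> j a b ab h c; apply: order_bound_le ab (h c).
- move=> j; have [a [a0 ha]] := H (j, false); have [b [b0 hb]] := H (j, true).
  have m0 : 0 < Rmin a b by apply: Rmin_case.
  exists (Rmin a b); split=> // -[].
    by apply: order_bound_le hb; split=> //; apply: Rmin_r.
  by apply: order_bound_le ha; split=> //; apply: Rmin_l.
(* The factor [4 * INR n] comes from [lipschitz_box], 2 from writing a real partial through two
   Wirtinger derivatives, and [2 ^ N] from bounding them on the box of radius [2 * r]. *)
set A := 4 * INR n * (2 * 2 ^ N).
have A0 : 0 <= A by rewrite /A; have := pos_INR n; have := pow_lt 2 N; nra.
set m := Rmin (rho / 2) (s / 2).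
have m0 : 0 < m by apply: Rmin_case; lra.
have mr : m <= rho / 2 by apply: Rmin_l.
have ms : m <= s / 2 by apply: Rmin_r.
set sigma := Rmin m (rho / (A + 1)).
have q0 : 0 < rho / (A + 1) by apply: Rdiv_lt_0_compat; lra.
have sg0 : 0 < sigma by apply: Rmin_case.
have sg1 : sigma <= m by apply: Rmin_l.
have sg2 : sigma <= rho / (A + 1) by apply: Rmin_r.
exists sigma; split=> // r [r0 rs] u v bu bv h h0 hh.
have P z : box (2 * r) z -> forall d, partial_at d f z /\ Cmod (pd d f z) <= 2 * ((2 * r) ^ N / rho).
  move=> bz [j b]; split.
    by apply: (c1 (j, b)).1; apply: box_le bz; lra.
  have k b' : Cmod (W (j, b') f z) <= (2 * r) ^ N / rho by apply: hr bz; lra.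
  have k1 := k false; have k2 := k true.
  rewrite pd_W; case: b.
    rewrite Cmod_mult Cmod_Ci Rmult_1_l; apply: Rle_trans (Cmod_triangle _ _) _.
    by rewrite Cmod_opp; lra.
  by apply: Rle_trans (Cmod_triangle _ _) _; lra.
apply: Rle_trans (lipschitz_box h0 P bu bv hh) _.
apply: Rmult_le_compat_r => //.
have -> : 4 * INR n * (2 * ((2 * r) ^ N / rho)) = A * / rho * r ^ N.
  by rewrite Rpow_mult_distr /A; field; lra.
rewrite /Rdiv Rmult_comm; apply: Rmult_le_compat_l; first by apply: pow_le; lra.
apply: (Rmult_le_reg_r sigma) => //; rewrite Rinv_l; last lra.
apply: Rle_trans (_ : A * / rho * (rho / (A + 1)) <= 1).
  by apply: Rmult_le_compat_l => //; apply: Rmult_le_pos => //; apply: Rlt_le; apply: Rinv_0_lt_compat.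
have -> : A * / rho * (rho / (A + 1)) = A / (A + 1) by field; lra.
apply: (Rmult_le_reg_r (A + 1)); first lra.
have -> : A / (A + 1) * (A + 1) = A by field; lra.
lra.
Qed.

Definition flat (n N : nat) (f : Cn n -> C) : Prop :=
  forall w : seq (dir n), (size w < N)%N -> foldW w f (@origin n) = RtoC 0.

Lemma flat_W n N (f : Cn n -> C) d : flat N.+1 f -> flat N (W d f).
Proof.
move=> H w hw; rewrite -[W d f]/(foldW [:: d] f) -foldW_cat; apply: H.
by rewrite size_cat addn1.
Qed.

(** Taylor's estimate by induction on [N]: the derivatives are O(r^N), so the function is Lipschitz
    with constant O(r^N) on [box r], and its vanishing at the origin yields one more power of r. For
    [N = 0] continuity at the origin gives boundedness. *)
Lemma flat_bound n N (f : Cn n -> C) : smooth f -> flat N f ->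
  exists rho, 0 < rho /\ order_bound N f rho.
Proof.
elim: N f => [|N ih] f sf fl.
  have [s [s0 c0]] := sf 0%N.
  have [d [d0 hd]] := c0 _ (@box_origin n s s0) 1 Rlt_0_1.
  set M := Cmod (f (@origin n)) + 1.
  have M0 : 0 < M by rewrite /M; have := Cmod_ge_0 (f (@origin n)); lra.
  have i0 := Rinv_0_lt_compat _ M0.
  exists (Rmin d (/ M)); split; first exact: Rmin_case.
  move=> r [r0 rs] w bw /=.
  have m0 : 0 < Rmin d (/ M) by apply: Rmin_case.
  apply: Rle_trans (_ : M <= _).
    have -> : (f w = (f w - f (@origin n)) + f (@origin n))%C by ring.
    apply: Rle_trans (Cmod_triangle _ _) _.
    have h : near_pt (@origin n) w d.
      by apply/near_origin; apply: box_le bw; apply: Rle_trans rs (Rmin_l _ _).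
    by have := hd w h; rewrite /M; lra.
  rewrite /Rdiv Rmult_1_l -[X in X <= _]Rinv_inv.
  by apply: Rinv_le_contravar => //; apply: Rmin_r.
have [|rho [r0 hl]] := @order_lipschitz_of_W n N f sf.
  by move=> d; apply: ih; [apply: smooth_W | apply: flat_W].
exists rho; split=> // r hr w bw.
have h := hl r hr (@origin n) w _ bw r.
have f0 : f (@origin n) = RtoC 0 by apply: (fl [::]).
rewrite f0 in h.
have -> : f w = (f w - RtoC 0)%C by ring.
apply: Rle_trans (h _ _ _) _.
- by apply: box_origin; lra.
- lra.
- by move=> j; have := bw j; rewrite /origin; have -> : (w j - 0 = w j)%C by [ring | ]; lra.
- by rewrite /=; apply: Req_le; field; lra.
Qed.

Lemma flat_lipschitz n N (f : Cn n -> C) : smooth f -> flat N.+1 f ->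
  exists rho, 0 < rho /\ order_lipschitz N f rho.
Proof.
move=> sf fl; apply: order_lipschitz_of_W => // d.
by apply: flat_bound; [apply: smooth_W | apply: flat_W].
Qed.

(** * Jets: Taylor polynomials as lists of terms *)

Definition word (n : nat) (X : expo n) : seq (dir n) :=
  block (fun j => X (j, false)) false (enum 'I_n) ++ block (fun j => X (j, true)) true (enum 'I_n).

Lemma count_word n (X : expo n) d : count_mem d (word X) = X d.
Proof.
case: d => j b; rewrite count_cat !count_block ?enum_uniq //= !mem_enum !andbT.
by case: b; rewrite /= ?addn0 ?add0n.
Qed.

Lemma Dkm_word n (k m : 'I_n -> nat) f : Dkm k m f = foldW (word (join k m)) f.
Proof. exact: DkmE. Qed.

Lemma ffall_word n (X : expo n) : RtoC (INR (ffall (word X) X)) <> RtoC 0.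
Proof.
have h : (0 < ffall (word X) X)%N by apply: ffall_gt0 => d; rewrite count_word.
by apply: RtoC_neq0; apply: not_0_INR => e; rewrite e in h.
Qed.

Definition expo_of (n N : nat) (p : {ffun dir n -> 'I_N.+1}) : expo n := fun d => nat_of_ord (p d).

(** The divisor is what the same derivative takes on [mono X] itself, so that the jet reproduces
    derivatives by duality. *)
Definition jet_coef (n : nat) (f : Cn n -> C) (X : expo n) : C :=
  (foldW (word X) f (@origin n) / RtoC (INR (ffall (word X) X)))%C.

(** Truncation is by each single exponent, so that the index set is a finite type of functions. All
    exponents of total degree at most [N] are included, which suffices for a remainder flat to order
    [N.+1]. *)
Definition jet (n N : nat) (f : Cn n -> C) : seq (C * expo n) :=
  [seq (jet_coef f (expo_of p), expo_of p) | p <- enum {ffun dir n -> 'I_N.+1}].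

(** By duality only the term of exponent [X] contributes. The filter [P] covers both the full jet
    and its quasi-homogeneous components. *)
Lemma foldW_jet n N (f : Cn n -> C) (X : expo n) (P : pred (expo n)) : (forall d, X d <= N)%N ->
  foldW (word X) (evalp [seq tm <- jet N f | P tm.2]) (@origin n) =
  if P X then foldW (word X) f (@origin n) else RtoC 0.
Proof.
move=> XN; pose p : {ffun dir n -> 'I_N.+1} := [ffun d => inord (X d)].
have pX : expo_of p = X.
  by apply: functional_extensionality => d; rewrite /expo_of ffunE inordK // ltnS.
rewrite foldW_evalp_origin /jet filter_map lsum_map /=.
have zero q : q != p -> foldW (word X) (mono (expo_of q)) (@origin n) = RtoC 0.
  move=> qp; rewrite foldW_mono_origin; case: ifP => // /forallP H.
  case/eqP: qp; apply/ffunP => d; apply: val_inj => /=.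
  by have := eqP (H d); rewrite count_word -pX.
have val : (jet_coef f (expo_of p) * foldW (word X) (mono (expo_of p)) (@origin n))%C =
    foldW (word X) f (@origin n).
  rewrite foldW_mono_origin pX; case: ifP => [_|/negP []]; last first.
    by apply/forallP => d; rewrite count_word.
  by rewrite /jet_coef; field; apply: ffall_word.
case: ifP => PX.
- rewrite (@lsum_single _ _ _ p) //.
  + by rewrite filter_uniq // enum_uniq.
  + by rewrite mem_filter /= pX PX mem_enum.
  + by move=> q /zero ->; ring.
- elim: (enum _) => //= q l ih; case: ifP => //= Pq; rewrite ih zero; first by ring.
  by apply: contraFN PX => /eqP e; rewrite -pX -e.
Qed.

Lemma flat_jet_remainder n N (f : Cn n -> C) : smooth f ->
  flat N.+1 (fun z => f z - evalp (jet N f) z)%C.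
Proof.
move=> sf w hw.
have E : (fun z => f z - evalp (jet N f) z)%C =
         (fun z => RtoC 1 * f z + - RtoC 1 * evalp (jet N f) z)%C.
  by apply: functional_extensionality => z; ring.
(* The word is replaced by the canonical one with the same letter counts; each count is at most the
   length of [w], hence at most [N], so [X] occurs in the jet. *)
pose X : expo n := fun d => count_mem d w.
have pe : perm_eq w (word X).
  by apply/allP => d _ /=; rewrite count_word.
have ss := smooth_lin (RtoC 1) (- RtoC 1)%C sf (smooth_evalp (jet N f)).
rewrite E (germ_at0 (germ_foldW_perm ss pe)).
rewrite (germ_at0 (germ_foldW_lin _ _ _ sf (smooth_evalp _))).
have XN d : (X d <= N)%N by rewrite -ltnS; apply: leq_ltn_trans (count_size _ _) hw.
have := @foldW_jet n N f X xpredT XN.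
by rewrite /= filter_predT => ->; ring.
Qed.

(** * Exponential sums along a leaf *)

(** Literally the factor in [quasi_hom], so that the two fold into each other. *)
Definition echar (a b : R) (t : C) : C :=
  Cmult (cexp (Cmult (RtoC (- a)) t)) (cexp (Cmult (RtoC (- b)) (Cconj t))).

Lemma cexp_add (v w : C) : cexp (v + w)%C = (cexp v * cexp w)%C.
Proof.
rewrite /cexp /Cmult /= -/(Re v) -/(Re w) -/(Im v) -/(Im w) exp_plus cos_plus sin_plus.
by f_equal; ring.
Qed.

Lemma cexp0 : cexp (RtoC 0) = RtoC 1.
Proof. by rewrite /cexp /= exp_0 cos_0 sin_0 /RtoC; f_equal; ring. Qed.

Lemma Cmod_cexp (w : C) : Cmod (cexp w) = exp (Re w).
Proof.
rewrite /Cmod /cexp /= -[RHS]sqrt_Rsqr; last exact: Rlt_le (exp_pos _).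
f_equal; have h := sin2_cos2 (Im w); rewrite /Rsqr in h *.
transitivity (exp (Re w) * exp (Re w) * (sin (Im w) * sin (Im w) + cos (Im w) * cos (Im w))).
  by ring.
by rewrite h; ring.
Qed.

Lemma cexp_conj (w : C) : Cconj (cexp w) = cexp (Cconj w).
Proof. by rewrite /cexp /Cconj /Re /Im /= cos_neg sin_neg; f_equal; ring. Qed.

Lemma cpow_cexp (w : C) k : cpow (cexp w) k = cexp (RtoC (INR k) * w)%C.
Proof.
elim: k => [|k ih]; first by rewrite Cmult_0_l cexp0.
rewrite -[LHS]/(cexp w * cpow (cexp w) k)%C ih -cexp_add S_INR RtoC_plus.
by f_equal; ring.
Qed.

Lemma echar_add a b s t : echar a b (s + t)%C = (echar a b s * echar a b t)%C.
Proof.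
rewrite /echar Cplus_conj.
have -> : (RtoC (- a) * (s + t) = RtoC (- a) * s + RtoC (- a) * t)%C by ring.
have -> : (RtoC (- b) * (Cconj s + Cconj t) = RtoC (- b) * Cconj s + RtoC (- b) * Cconj t)%C by ring.
by rewrite !cexp_add; ring.
Qed.

Lemma echar_plus a b a' b' t : echar (a + a') (b + b') t = (echar a b t * echar a' b' t)%C.
Proof.
rewrite /echar !Ropp_plus_distr !RtoC_plus.
have -> : ((RtoC (- a) + RtoC (- a')) * t = RtoC (- a) * t + RtoC (- a') * t)%C by ring.
have -> : ((RtoC (- b) + RtoC (- b')) * Cconj t = RtoC (- b) * Cconj t + RtoC (- b') * Cconj t)%C by ring.
by rewrite !cexp_add; ring.
Qed.

Lemma echar00 t : echar 0 0 t = RtoC 1.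
Proof. by rewrite /echar Ropp_0 !Cmult_0_l cexp0; ring. Qed.

Lemma Cmod_echar a b t : Cmod (echar a b t) = exp (- (a + b) * Re t).
Proof.
rewrite /echar Cmod_mult !Cmod_cexp -exp_plus; f_equal.
by rewrite !re_scal_l re_conj; ring.
Qed.

Lemma echar_neq0 a b t : echar a b t <> RtoC 0.
Proof. by move=> h; have := Cmod_echar a b t; rewrite h Cmod_0; have := exp_pos (- (a + b) * Re t); lra. Qed.

(** If the sums of the degrees agree, the moduli agree, and an imaginary [tau] is chosen to make the
    phases differ by pi; otherwise the moduli already differ at 1. The condition [0 <= Re tau]
    ensures that a shift by [tau] stays in the half-plane where a bound is known. *)
Lemma echar_separated a b a' b' : (a, b) <> (a', b') ->
  exists tau, 0 <= Re tau /\ echar a b tau <> echar a' b' tau.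
Proof.
move=> ne; case: (Req_dec (a + b) (a' + b')) => [e|e].
- have d0 : (a - b) - (a' - b') <> 0.
    by move=> h; apply: ne; f_equal; lra.
  set y := PI / ((a - b) - (a' - b')).
  exists (0, y); split; first by rewrite /=; lra.
  move=> h; suff : echar a b (0, y) = (- echar a' b' (0, y))%C.
    rewrite h => k; apply: (@echar_neq0 a' b' (0, y)).
    have -> : echar a' b' (0, y) = (/ RtoC 2 * (echar a' b' (0, y) - - echar a' b' (0, y)))%C by field.
    by rewrite -k; ring.
  have red c d : echar c d (0, y) = (cos ((c - d) * y), - sin ((c - d) * y)).
    rewrite /echar -cexp_add /cexp /=.
    have -> : - c * 0 - 0 * y + (- d * 0 - 0 * - y) = 0 by ring.
    have -> : - c * y + 0 * 0 + (- d * - y + 0 * 0) = - ((c - d) * y) by ring.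
    by rewrite exp_0 cos_neg sin_neg; f_equal; ring.
  rewrite !red; have -> : (a - b) * y = (a' - b') * y + PI by rewrite /y; field.
  by rewrite neg_cos neg_sin /Copp /=.
- exists (RtoC 1); split; first by rewrite /=; lra.
  move=> h; have := Cmod_echar a b (RtoC 1); rewrite h Cmod_echar /= !Rmult_1_r => /exp_inv k.
  by apply: e; lra.
Qed.

Lemma exp_decay_zero (c K a M X0 : R) : a < M -> 0 <= c ->
  (forall x, X0 < x -> c * exp (- a * x) <= K * exp (- M * x)) -> c = 0.
Proof.
move=> aM c0 H; apply: Rle_antisym => //; apply: Rnot_lt_le => cp.
(* The bound reads c exp((M - a) x) <= K; since exp y >= 1 + y, it fails as soon as c (M - a) x >=
   K. *)
set x := Rmax (X0 + 1) (K / (c * (M - a))).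
have x1 : X0 + 1 <= x by apply: Rmax_l.
have x2 : K / (c * (M - a)) <= x by apply: Rmax_r.
have p : 0 < c * (M - a) by apply: Rmult_lt_0_compat; lra.
have h := H x ltac:(lra).
have E : exp (- a * x) = exp ((M - a) * x) * exp (- M * x) by rewrite -exp_plus; f_equal; ring.
have h2 : c * exp ((M - a) * x) <= K.
  by apply: (Rmult_le_reg_r (exp (- M * x))); [apply: exp_pos | rewrite E in h; lra].
have h3 := exp_ineq1_le ((M - a) * x).
have h4 : K <= x * (c * (M - a)).
  have -> : K = K / (c * (M - a)) * (c * (M - a)) by field; lra.
  by apply: Rmult_le_compat_r; lra.
nra.
Qed.

Definition expsum (s : seq (C * (R * R))) (t : C) : C :=
  lsum (fun tm => tm.1 * echar tm.2.1 tm.2.2 t)%C s.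

(* Replacing [S] by [S(. + tau) - echar_i(tau) S] removes the [i]-th exponential and multiplies the
   others by constants, so the isolated exponential survives with a nonzero factor. *)
Lemma expsum_isolated (s : seq (C * (R * R))) (a b M X0 : R) c K :
  List.Forall (fun tm => tm.2 <> (a, b)) s -> a + b < M ->
  (forall t, X0 < Re t -> Cmod (c * echar a b t + expsum s t)%C <= K * exp (- M * Re t)) ->
  c = RtoC 0.
Proof.
move=> sep aM; move: {2}(size s) (leqnn (size s)) => m.
elim: m s sep c K => [|m ih] [|[c1 [a1 b1]] s] sep c K //= sz H; try
 (apply: Cmod_eq_0; apply: (@exp_decay_zero _ K (a + b) M X0) => //; first exact: Cmod_ge_0;
  move=> x hx; have := H (RtoC x) hx;
  by rewrite /expsum /= Cplus_0_r Cmod_mult Cmod_echar).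
have ne := List.Forall_inv sep; have {}sep := List.Forall_inv_tail sep.
have [tau [t0 ht]] := echar_separated ne.
set mu := echar a1 b1 tau in ht *.
pose s' := [seq (tm.1 * (echar tm.2.1 tm.2.2 tau - mu), tm.2)%C | tm <- s].
have Z : (c * (echar a b tau - mu))%C = RtoC 0.
  apply: (ih s' _ _ (K * exp (- M * Re tau) + Cmod mu * K)).
  - by rewrite /s'; elim: (s) sep => //= tm l il /List.Forall_cons_iff [h1 h2]; constructor; auto.
  - by rewrite size_map.
  move=> t ht0.
  set S := fun t => (c * echar a b t + expsum ((c1, (a1, b1)) :: s) t)%C in H.
  have -> : (c * (echar a b tau - mu) * echar a b t + expsum s' t = S (t + tau) - mu * S t)%C.
    rewrite /S /expsum /= lsum_map /= !echar_add -/mu.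
    have -> : lsum (fun tm => tm.1 * (echar tm.2.1 tm.2.2 tau - mu) * echar tm.2.1 tm.2.2 t)%C s =
       (lsum (fun tm => tm.1 * echar tm.2.1 tm.2.2 (t + tau)) s
        - mu * lsum (fun tm => tm.1 * echar tm.2.1 tm.2.2 t) s)%C.
      by elim: (s) => [|tm l il] /=; [ring | rewrite il echar_add; ring].
    by ring.
  have h1 : Cmod (S t) <= K * exp (- M * Re t) by apply: H.
  have h2 : Cmod (S (t + tau)%C) <= K * exp (- M * Re (t + tau)%C) by apply: H; rewrite re_plus; lra.
  rewrite re_plus Rmult_plus_distr_l exp_plus in h2.
  apply: Rle_trans (Cmod_triangle _ _) _; rewrite Cmod_opp Cmod_mult.
  have := Cmod_ge_0 mu; nra.
have nz : (echar a b tau - mu)%C <> RtoC 0 by move/Cminus_eq0 => e; apply: ht.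
have -> : c = (c * (echar a b tau - mu) / (echar a b tau - mu))%C by field.
by rewrite Z /Cdiv Cmult_0_l.
Qed.

(** Bidegrees are pairs of reals, whose equality is decided classically in order to have a boolean
    filter. *)
Definition exp_pred (a b : R) (p : R * R) : bool :=
  if excluded_middle_informative (p = (a, b)) then true else false.

Lemma exp_predP a b p : reflect (p = (a, b)) (exp_pred a b p).
Proof. by rewrite /exp_pred; case: excluded_middle_informative => h; constructor. Qed.

(** Terms of equal bidegree are grouped first, as only the sum of their coefficients is determined;
    the remaining terms then satisfy the separation hypothesis of [expsum_isolated]. *)
Lemma expsum_coef (s : seq (C * (R * R))) (a b M X0 : R) K : a + b < M ->
  (forall t, X0 < Re t -> Cmod (expsum s t) <= K * exp (- M * Re t)) ->
  lsum (fun tm => tm.1) [seq tm <- s | exp_pred a b tm.2] = RtoC 0.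
Proof.
move=> aM H.
apply: (@expsum_isolated [seq tm <- s | predC (fun tm => exp_pred a b tm.2) tm] a b M X0 _ K) => //.
- by elim: s {H} => //= tm s ih; case: exp_predP => //= h; constructor.
- move=> t /H; rewrite /expsum (lsum_filter (fun tm => exp_pred a b tm.2) _ s).
  suff -> : lsum (fun tm => tm.1 * echar tm.2.1 tm.2.2 t)%C [seq tm <- s | exp_pred a b tm.2] =
    (lsum (fun tm => tm.1) [seq tm <- s | exp_pred a b tm.2] * echar a b t)%C by [].
  elim: (s) => /= [|tm l ih]; first by ring.
  case E: (exp_pred a b tm.2) => /=; last exact: ih.
  have -> : tm.2 = (a, b) by apply/exp_predP.
  by rewrite ih /=; ring.
Qed.

Lemma isd_cexp (c : C) : isd (fun s => cexp (c * RtoC s)%C) 0 c.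
Proof.
have E s : cexp (c * RtoC s)%C = (exp (Re c * s) * cos (Im c * s), exp (Re c * s) * sin (Im c * s)).
  by rewrite /cexp re_scal_r im_scal_r.
apply: (@isd_ext (fun s => (exp (Re c * s) * cos (Im c * s), exp (Re c * s) * sin (Im c * s)))).
  by move=> s; rewrite E.
split; rewrite /=; auto_derive => //; rewrite !Rmult_0_r exp_0 cos_0 sin_0 /Re /Im; ring.
Qed.

(** The logarithmic derivative of [echar d1 d2] in the direction 1 or i. *)
Definition char_rate (b : bool) (d1 d2 : R) : C :=
  (RtoC (- d1) * unit_of b + RtoC (- d2) * Cconj (unit_of b))%C.

Lemma isd_echar d1 d2 b t :
  isd (fun s => echar d1 d2 (t + unit_of b * RtoC s)%C) 0 (char_rate b d1 d2 * echar d1 d2 t)%C.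
Proof.
have h := isd_scal (echar d1 d2 t) (isd_mult (isd_cexp (RtoC (- d1) * unit_of b))
  (isd_cexp (RtoC (- d2) * Cconj (unit_of b)))).
apply: isd_ext (isd_val h _).
- move=> s; rewrite echar_add; congr (_ * _)%C.
  by rewrite /echar Cmult_conj Cconj_RtoC; congr (_ * _)%C; f_equal; ring.
- by rewrite !Cmult_0_r cexp0 /char_rate; ring.
Qed.

(** The left side is the eigenvalue of twice the d-bar operator on exp(-d1 t - d2 conj t), in which
    only the second factor is not holomorphic. *)
Lemma char_rate_dbar d1 d2 :
  (char_rate false d1 d2 + Ci * char_rate true d1 d2)%C = RtoC (- 2 * d2).
Proof.
rewrite /char_rate /= Cconj_RtoC.
have -> : Cconj Ci = (- Ci)%C by rewrite /Cconj /Ci /Copp /=; f_equal; ring.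
transitivity (RtoC (- d1) * (RtoC 1 + Ci * Ci) + RtoC (- d2) * (RtoC 1 - Ci * Ci))%C; first by ring.
have -> : RtoC (- 2 * d2) = (RtoC (- d2) + RtoC (- d2))%C by rewrite -RtoC_plus; f_equal; ring.
by rewrite Ci_sqr; ring.
Qed.

(** The components of the bidegree of [mono X]: d1 for [b = false], d2 for [b = true]. *)
Definition weight (n : nat) (lam : 'I_n -> R) (b : bool) (X : expo n) : R :=
  rsum (fun j => lam j * INR (X (j, b))).

Lemma cprod_echar n (g h : 'I_n -> R) t :
  cprod (fun j => echar (g j) (h j) t) = echar (rsum g) (rsum h) t.
Proof.
rewrite /cprod /rsum; elim: (enum 'I_n) => /= [|j l ->]; first by rewrite echar00.
by rewrite echar_plus.
Qed.

Lemma mono_Phi n (lam : 'I_n -> R) (X : expo n) z t :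
  mono X (Phi lam z t) = (echar (weight lam false X) (weight lam true X) t * mono X z)%C.
Proof.
rewrite /weight -cprod_echar -cprod_mul; apply: cprod_ext => j.
rewrite /Phi Cmult_conj !cpow_mul cexp_conj !cpow_cexp Cmult_conj Cconj_RtoC /echar.
have e k w : (RtoC (INR k) * (RtoC (- lam j) * w) = RtoC (- (lam j * INR k)) * w)%C.
  by rewrite !RtoC_opp RtoC_mult; ring.
by rewrite !e; ring.
Qed.

Definition leaf_terms (n : nat) (lam : 'I_n -> R) (z : Cn n) (s : seq (C * expo n)) :
  seq (C * (R * R)) :=
  [seq (tm.1 * mono tm.2 z, (weight lam false tm.2, weight lam true tm.2))%C | tm <- s].

Lemma evalp_Phi n (lam : 'I_n -> R) (s : seq (C * expo n)) z t :
  evalp s (Phi lam z t) = expsum (leaf_terms lam z s) t.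
Proof.
by rewrite /expsum lsum_map; apply: eq_lsum => tm; rewrite mono_Phi /=; ring.
Qed.

Lemma isd_expsum (s : seq (C * (R * R))) b t :
  isd (fun x => expsum s (t + unit_of b * RtoC x)%C) 0
      (expsum [seq (tm.1 * char_rate b tm.2.1 tm.2.2, tm.2)%C | tm <- s] t).
Proof.
elim: s => [|tm s ih]; first exact: isd_const.
apply: isd_val (isd_plus (isd_scal tm.1 (isd_echar tm.2.1 tm.2.2 b t)) ih) _.
by rewrite /expsum /=; ring.
Qed.

Lemma exp_pow_nat x N : exp x ^ N = exp (INR N * x).
Proof.
elim: N => [|N ih]; first by rewrite /= Rmult_0_l exp_0.
by rewrite -tech_pow_Rmult ih -exp_plus S_INR; f_equal; ring.
Qed.

Lemma exp_eventually_small (mu e : R) : 0 < mu -> 0 < e ->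
  exists X0, 0 <= X0 /\ forall x, X0 < x -> exp (- mu * x) <= e.
Proof.
move=> m0 e0; have q : 0 < / (e * mu) by apply: Rinv_0_lt_compat; apply: Rmult_lt_0_compat.
(* From exp(mu x) >= mu x one gets exp(-mu x) <= 1 / (mu x), which is at most [e] beyond this
   threshold. *)
exists (/ (e * mu)); split; first lra.
move=> x hx; have h := exp_ineq1_le (mu * x).
have E : exp (- mu * x) * exp (mu * x) = 1 by rewrite -exp_plus -exp_0; f_equal; ring.
have p := exp_pos (- mu * x).
have k : 1 <= e * (mu * x).
  have -> : 1 = e * mu * / (e * mu) by field; lra.
  by rewrite -Rmult_assoc; apply: Rmult_le_compat_l; [apply: Rlt_le; apply: Rmult_lt_0_compat | lra].
have k2 : exp (- mu * x) * (mu * x) <= 1 by rewrite -E; apply: Rmult_le_compat_l; lra.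
have k3 : 0 < mu * x by apply: Rmult_lt_0_compat; lra.
by apply: (Rmult_le_reg_r (mu * x)) => //; lra.
Qed.

Lemma leaf_scale n (lam : 'I_n -> R) (z : Cn n) :
  exists A, 0 < A /\ forall j, lam j <= A /\ Cmod (z j) <= A.
Proof.
(* The inverse of the wanted upper bound is produced as a common small radius. *)
have [||a [a0 ha]] := @ord_uniform_pos n (fun j a => lam j * a <= 1 /\ Cmod (z j) * a <= 1).
- move=> j r s sr [h1 h2]; have := Cmod_ge_0 (z j).
  by split; [case: (Rle_dec (lam j) 0) => ?|]; nra.
- move=> j; set m := Rabs (lam j) + Cmod (z j) + 1.
  have m0 : 0 < m by rewrite /m; have := Rabs_pos (lam j); have := Cmod_ge_0 (z j); lra.
  have i0 := Rinv_0_lt_compat _ m0.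
  have l1 := Rle_abs (lam j); have l2 := Rabs_pos (lam j); have l3 := Cmod_ge_0 (z j).
  exists (/ m); split=> //; split; apply: (Rmult_le_reg_r m) => //;
    rewrite Rmult_assoc Rinv_l /m; lra.
exists (/ a); split; first exact: Rinv_0_lt_compat.
move=> j; have [h1 h2] := ha j; split; apply: (Rmult_le_reg_r a) => //; rewrite Rinv_l; lra.
Qed.

Lemma Cmod_Phi n (lam : 'I_n -> R) (z : Cn n) t j :
  Cmod (Phi lam z t j) = Cmod (z j) * exp (- lam j * Re t).
Proof. by rewrite /Phi Cmod_mult Cmod_cexp re_scal_l. Qed.

Lemma Cmod_Phi_le n (lam : 'I_n -> R) mu A (z : Cn n) t j : (forall j, mu <= lam j) ->
  (forall j, Cmod (z j) <= A) -> 0 <= Re t -> Cmod (Phi lam z t j) <= A * exp (- mu * Re t).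
Proof.
move=> hm hA t0; rewrite Cmod_Phi; apply: Rmult_le_compat => //.
- exact: Cmod_ge_0.
- exact: Rlt_le (exp_pos _).
- case: (Rle_lt_or_eq_dec (- lam j * Re t) (- mu * Re t)).
  + by have := hm j; nra.
  + by move=> h; apply: Rlt_le; apply: exp_increasing.
  + by move=> ->; apply: Rle_refl.
Qed.

(** The leaf enters boxes of radius proportional to exp(-mu Re t). The radius is [2 * A * e] rather
    than [A * e] because boxes are defined by strict inequalities. *)
Lemma leaf_flat n (lam : 'I_n -> R) mu N (f : Cn n -> C) (z : Cn n) : 0 < mu ->
  (forall j, mu <= lam j) -> smooth f -> flat N f ->
  exists X0 K, 0 <= X0 /\ forall t, X0 < Re t -> Cmod (f (Phi lam z t)) <= K * exp (- (INR N * mu) * Re t).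
Proof.
move=> m0 hm sf fl; have [A [A0 hA]] := leaf_scale lam z.
have [rho [r0 hr]] := flat_bound sf fl.
have e0 : 0 < rho / (2 * A) by apply: Rdiv_lt_0_compat; lra.
have [X0 [X00 hX]] := exp_eventually_small m0 e0.
exists X0, ((2 * A) ^ N / rho); split=> // t ht.
set e := exp (- mu * Re t); have p : 0 < e by apply: exp_pos.
have le : 2 * A * e <= rho.
  have := hX _ ht; rewrite -/e => h.
  have -> : rho = 2 * A * (rho / (2 * A)) by field; lra.
  by apply: Rmult_le_compat_l; lra.
have pos : 0 < 2 * A * e by apply: Rmult_lt_0_compat; lra.
have b : box (2 * A * e) (Phi lam z t).
  move=> j; apply: Rle_lt_trans (_ : A * e < _); last by nra.
  by apply: Cmod_Phi_le => //; [move=> i; apply: (hA i).2 | lra].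
apply: Rle_trans (hr _ (conj pos le) _ b) _; apply: Req_le.
rewrite Rpow_mult_distr /e exp_pow_nat.
have -> : INR N * (- mu * Re t) = - (INR N * mu) * Re t by ring.
by rewrite /Rdiv; ring.
Qed.

(** The Cauchy-Riemann equations: one complex number [l] gives the derivatives in both real
    directions. *)
Lemma isd_of_C_differentiable (g : C -> C) t : C_differentiable g t ->
  exists l, forall b, isd (fun s => g (t + unit_of b * RtoC s)%C) 0 (unit_of b * l)%C.
Proof.
move=> [l H]; exists l => b; apply: isd_of_quotients => e /H [d [d0 hd]].
exists d; split=> // h h0 hlt; rewrite Rplus_0_l Cmult_0_r Cplus_0_r.
have u0 : unit_of b <> RtoC 0 by move=> u; have := Cmod_unit_of b; rewrite u Cmod_0; lra.
have hh : RtoC h <> RtoC 0 by apply: RtoC_neq0.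
have -> : ((g (t + unit_of b * RtoC h) - g t) / RtoC h - unit_of b * l =
  unit_of b * ((g (t + unit_of b * RtoC h) - g t) / (unit_of b * RtoC h) - l))%C by field.
rewrite Cmod_mult Cmod_unit_of Rmult_1_l; apply: hd; first exact: Cmult_neq_0.
by rewrite Cmod_mult Cmod_unit_of Cmod_R Rmult_1_l.
Qed.

Lemma Phi_shift n (lam : 'I_n -> R) (z : Cn n) t h j :
  Phi lam z (t + h)%C j = (Phi lam z t j * cexp (RtoC (- lam j) * h))%C.
Proof. by rewrite /Phi Cmult_plus_distr_l cexp_add; ring. Qed.

(** The derivative of each coordinate is at most [A * A] in modulus; the extra 1 is the tolerance
    taken in the first order approximation. *)
Lemma Phi_increment n (lam : 'I_n -> R) A (z : Cn n) t b : 0 < A ->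
  (forall j, 0 < lam j <= A /\ Cmod (z j) <= A) -> 0 <= Re t ->
  exists d, 0 < d /\ forall j h, Rabs h < d ->
    Cmod (Phi lam z (t + unit_of b * RtoC h) j - Phi lam z t j)%C <= (A * A + 1) * Rabs h.
Proof.
move=> A0 hA t0.
apply: (@ord_uniform_pos n (fun j d => forall h, Rabs h < d ->
    Cmod (Phi lam z (t + unit_of b * RtoC h) j - Phi lam z t j)%C <= (A * A + 1) * Rabs h)).
  by move=> j r s sr H h hs; apply: H; lra.
move=> j.
have D : isd (fun h => Phi lam z (t + unit_of b * RtoC h)%C j) 0
             (Phi lam z t j * (RtoC (- lam j) * unit_of b))%C.
  apply: isd_ext (isd_scal _ (isd_cexp _)) => h.
  by rewrite Phi_shift; congr (_ * cexp _)%C; ring.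
have [d [d0 hd]] := isd_approx D Rlt_0_1.
exists d; split=> // h /hd; rewrite Rplus_0_l Cmult_0_r Cplus_0_r.
set V := (Phi _ _ _ _ - Phi _ _ _ _)%C; set L := (Phi lam z t j * _)%C => hv.
have -> : V = ((V - L * RtoC h) + L * RtoC h)%C by ring.
apply: Rle_trans (Cmod_triangle _ _) _; rewrite Cmod_mult Cmod_R.
have LA : Cmod L <= A * A.
  rewrite /L (Cmod_mult (Phi lam z t j)) (Cmod_mult (RtoC _)) Cmod_unit_of Cmod_R Rabs_Ropp Rmult_1_r.
  have [[l0 lA] zA] := hA j; rewrite (Rabs_pos_eq (lam j)); last lra.
  apply: Rmult_le_compat => //; [exact: Cmod_ge_0 | lra |].
  rewrite Cmod_Phi; have e1 : exp (- lam j * Re t) <= 1.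
    rewrite -exp_0; case: (Rle_lt_or_eq_dec (- lam j * Re t) 0); first by nra.
      by move=> h'; apply: Rlt_le; apply: exp_increasing.
    by move=> ->; apply: Rle_refl.
  have := exp_pos (- lam j * Re t); have := Cmod_ge_0 (z j); nra.
have := Rabs_pos h; nra.
Qed.

(* With [f = P + R] near [0], [P] a Taylor polynomial, the Cauchy-Riemann equation for
   [f o Phi] expresses the d-bar derivative of [P o Phi] through that of [R o Phi], which the
   Lipschitz constant of the flat remainder [R] controls. *)
Lemma leaf_dbar n (lam : 'I_n -> R) mu N (f : Cn n -> C) (z : Cn n) : 0 < mu ->
  (forall j, mu <= lam j) -> smooth f ->
  (forall t, Hplane t -> C_differentiable (fun s => f (Phi lam z s)) t) ->
  exists X0 K, forall t, X0 < Re t ->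
    Cmod (expsum [seq (tm.1 * RtoC (- 2 * tm.2.2), tm.2)%C | tm <- leaf_terms lam z (jet N f)] t)
      <= K * exp (- (INR N * mu) * Re t).
Proof.
move=> m0 hm sf hol; have [A [A0 hA]] := leaf_scale lam z.
have hA' j : 0 < lam j <= A /\ Cmod (z j) <= A by have := hA j; have := hm j; lra.
set P := jet N f; pose Rm z := (f z - evalp P z)%C.
have sR : smooth Rm.
  have := smooth_lin (RtoC 1) (- RtoC 1)%C sf (smooth_evalp P).
  suff -> : (fun w => RtoC 1 * f w + - RtoC 1 * evalp P w)%C = Rm by [].
  by apply: functional_extensionality => w; rewrite /Rm; ring.
have [rho [r0 hr]] := flat_lipschitz sR (@flat_jet_remainder n N f sf).
have e0 : 0 < rho / (2 * A) by apply: Rdiv_lt_0_compat; lra.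
have [X0 [X00 hX]] := exp_eventually_small m0 e0.
exists X0, (2 * ((2 * A) ^ N / rho * (A * A + 1))) => t ht.
have t0 : 0 < Re t by lra.
set e := exp (- mu * Re t); have p : 0 < e by apply: exp_pos.
set r := 2 * A * e.
have le : r <= rho.
  have := hX _ ht; rewrite -/e => h.
  have -> : rho = 2 * A * (rho / (2 * A)) by field; lra.
  by apply: Rmult_le_compat_l; lra.
have pos : 0 < r by apply: Rmult_lt_0_compat; lra.
have small j : Cmod (Phi lam z t j) <= A * e.
  by apply: Cmod_Phi_le => //; [move=> i; apply: (hA i).2 | lra].
have Ae : 0 < A * e by apply: Rmult_lt_0_compat.
have bt : box r (Phi lam z t) by move=> j; have := small j; rewrite /r; lra.
have [l hl] := isd_of_C_differentiable (hol t t0).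
set T := leaf_terms lam z P.
pose dP b := expsum [seq (tm.1 * char_rate b tm.2.1 tm.2.2, tm.2)%C | tm <- T] t.
have dR b : isd (fun s => Rm (Phi lam z (t + unit_of b * RtoC s)%C)) 0 (unit_of b * l - dP b)%C.
  have h := isd_plus (hl b) (isd_scal (- RtoC 1)%C (isd_expsum T b t)).
  apply: isd_ext (isd_val h _); last by rewrite /dP; ring.
  by move=> s; rewrite /Rm evalp_Phi /T; ring.
have bd b : Cmod (unit_of b * l - dP b)%C <= r ^ N / rho * (A * A + 1).
  apply: isd_le (dR b) _.
  have [d [d0 hd]] := @Phi_increment n lam A z t b A0 hA' (Rlt_le _ _ t0).
  (* For displacements below this bound the leaf moves by less than [A * e], so the shifted point
     stays in [box r] with [r = 2 * A * e]. *)
  have q0 : 0 < A * e / (A * A + 1) by apply: Rdiv_lt_0_compat => //; nra.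
  exists (Rmin d (A * e / (A * A + 1))); split; first exact: Rmin_case.
  move=> h hh; have h1 := Rlt_le_trans _ _ _ hh (Rmin_l _ _); have h2 := Rlt_le_trans _ _ _ hh (Rmin_r _ _).
  rewrite Rplus_0_l Cmult_0_r Cplus_0_r Rmult_assoc.
  have B0 : 0 < A * A + 1 by nra.
  have h3 : (A * A + 1) * Rabs h < A * e.
    have -> : A * e = (A * A + 1) * (A * e / (A * A + 1)) by field; lra.
    exact: Rmult_lt_compat_l.
  apply: (hr r (conj pos le)) => //.
  - move=> j; have -> : Phi lam z (t + unit_of b * RtoC h)%C j =
        ((Phi lam z (t + unit_of b * RtoC h) j - Phi lam z t j) + Phi lam z t j)%C by ring.
    apply: Rle_lt_trans (Cmod_triangle _ _) _.
    by have := hd j h h1; have := small j; rewrite /r; lra.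
  - by have := Rabs_pos h; nra.
  - by move=> j; apply: hd.
have -> : expsum [seq (tm.1 * RtoC (- 2 * tm.2.2), tm.2)%C | tm <- T] t = (dP false + Ci * dP true)%C.
  rewrite /dP; elim: (T) => [|tm s ih]; first by rewrite /expsum /=; ring.
  rewrite /expsum /= -!/(expsum _ t) ih -(char_rate_dbar tm.2.1 tm.2.2); ring.
have -> : (dP false + Ci * dP true = - ((unit_of false * l - dP false) + Ci * (unit_of true * l - dP true)))%C.
  transitivity (dP false + Ci * dP true - l * (RtoC 1 + Ci * Ci))%C; last by rewrite /=; ring.
  by rewrite Ci_sqr; ring.
rewrite Cmod_opp; apply: Rle_trans (Cmod_triangle _ _) _; rewrite Cmod_mult Cmod_Ci Rmult_1_l.
have b1 := bd false; have b2 := bd true.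
have E : r ^ N = (2 * A) ^ N * exp (- (INR N * mu) * Re t).
  by rewrite /r Rpow_mult_distr /e exp_pow_nat; f_equal; f_equal; ring.
rewrite E in b1 b2; have {b1 b2} := Rplus_le_compat _ _ _ _ b1 b2.
by move=> h; apply: Rle_trans h _; apply: Req_le; rewrite /Rdiv; ring.
Qed.

(** * Products of polynomials *)

Fixpoint peval (l : seq C) (s : R) : C :=
  if l is c :: l' then (c + RtoC s * peval l' s)%C else RtoC 0.

Fixpoint padd (l m : seq C) : seq C :=
  match l, m with
  | [::], _ => m
  | _, [::] => l
  | c :: l', d :: m' => (c + d)%C :: padd l' m'
  end.

Definition line_poly (g : R -> C) : Prop := exists l, forall s, g s = peval l s.

Lemma line_poly_plus g h : line_poly g -> line_poly h -> line_poly (fun s => g s + h s)%C.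
Proof.
move=> [l hl] [m hm]; exists (padd l m) => s; rewrite hl hm {hl hm}.
elim: l m => [|c l ih] [|d m] /=; try by ring.
by rewrite -ih; ring.
Qed.

Lemma line_poly_const c : line_poly (fun _ => c).
Proof. by exists [:: c] => s /=; ring. Qed.

Lemma line_poly_mult g h : line_poly g -> line_poly h -> line_poly (fun s => g s * h s)%C.
Proof.
move=> [l hl] hh; have [m hm] : line_poly (fun s => peval l s * h s)%C.
  elim: l {hl} => [|c l [m hm]]; first by exists [::] => s /=; ring.
  have [m' hm'] := hh.
  have scal : line_poly (fun s => c * h s)%C.
    exists [seq (c * d)%C | d <- m'] => s; rewrite hm'; elim: (m') => /= [|d k <-]; ring.
  have shf : line_poly (fun s => RtoC s * (peval l s * h s))%C.
    by exists (RtoC 0 :: m) => s; rewrite hm /=; ring.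
  have [k hk] := line_poly_plus scal shf; exists k => s; rewrite -hk /=; ring.
by exists m => s; rewrite hl hm.
Qed.

Lemma line_poly_pow g k : line_poly g -> line_poly (fun s => cpow (g s) k).
Proof.
move=> h; elim: k => [|k ih]; [exact: line_poly_const | exact: line_poly_mult].
Qed.

(** The parameter of the line is real, so conjugation leaves it fixed and the conjugated coordinates
    are polynomial in it as well. *)
Lemma line_poly_evalp n (p : seq (C * expo n)) (z w : Cn n) :
  line_poly (fun s => evalp p (fun j => z j + RtoC s * (w j - z j))%C).
Proof.
elim: p => [|tm p ih]; first exact: line_poly_const.
apply: line_poly_plus ih; apply: line_poly_mult; first exact: line_poly_const.
rewrite /mono /monomial /cprod; elim: (enum 'I_n) => [|j l ih] /=; first exact: line_poly_const.
apply: line_poly_mult ih; apply: line_poly_mult; apply: line_poly_pow.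
  by exists [:: z j; (w j - z j)%C] => s /=; ring.
exists [:: Cconj (z j); Cconj (w j - z j)%C] => s /=.
by rewrite Cplus_conj Cmult_conj Cconj_RtoC; ring.
Qed.

Lemma peval_bounded l : exists B, forall s, 0 < s < 1 -> Cmod (peval l s) <= B.
Proof.
elim: l => [|c l [B hB]]; first by exists 0 => s _; rewrite Cmod_0; lra.
exists (Cmod c + B) => s hs /=.
apply: Rle_trans (Cmod_triangle _ _) _; apply: Rplus_le_compat_l.
rewrite Cmod_mult Cmod_R Rabs_pos_eq; last lra.
have := hB s hs; have := Cmod_ge_0 (peval l s); nra.
Qed.

(** Leading zero coefficients only contribute powers of s. The first nonzero coefficient [c] then
    dominates the rest as soon as s times a bound of the rest is below [Cmod c]. *)
Lemma peval_near0 l : (forall s, peval l s = RtoC 0) \/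
  exists d, 0 < d /\ forall s, 0 < s < d -> peval l s <> RtoC 0.
Proof.
elim: l => [|c l ih]; first by left.
case: (Ceq_dec c (RtoC 0)) => [->|c0].
  case: ih => [z|[d [d0 hd]]]; first by left=> s /=; rewrite z; ring.
  right; exists d; split=> // s hs /=; rewrite Cplus_0_l; apply: Cmult_neq_0; last exact: hd.
  by apply: RtoC_neq0; lra.
right; have [B hB] := peval_bounded l.
have cp : 0 < Cmod c by apply/Cmod_gt_0.
have B1 : 0 < Rabs B + 1 by have := Rabs_pos B; lra.
have q : 0 < Cmod c / (Rabs B + 1) by apply: Rdiv_lt_0_compat.
exists (Rmin 1 (Cmod c / (Rabs B + 1))); split; first by apply: Rmin_case; lra.
move=> s [s0 s1] /= e.
have l1 := Rlt_le_trans _ _ _ s1 (Rmin_l _ _); have l2 := Rlt_le_trans _ _ _ s1 (Rmin_r _ _).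
have ce : c = (- (RtoC s * peval l s))%C.
  by have -> : c = (c + RtoC s * peval l s - RtoC s * peval l s)%C; [ring | rewrite e; ring].
have h := hB s (conj s0 l1); have hp := Cmod_ge_0 (peval l s).
have : Cmod c < Cmod c.
  rewrite {1}ce Cmod_opp Cmod_mult Cmod_R Rabs_pos_eq; last lra.
  apply: Rle_lt_trans (_ : s * (Rabs B + 1) < _).
    by apply: Rmult_le_compat_l; [lra | have := Rle_abs B; lra].
  have -> : Cmod c = Cmod c / (Rabs B + 1) * (Rabs B + 1) by field; lra.
  exact: Rmult_lt_compat_r.
lra.
Qed.

(** On the real line through [z] and [w] neither restriction vanishes identically, so both are
    nonzero at all small positive parameters. This replaces the absence of zero divisors among
    polynomials. *)
Lemma evalp_mult_neq0 n (p q : seq (C * expo n)) z w :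
  evalp p z <> RtoC 0 -> evalp q w <> RtoC 0 ->
  exists v, evalp p v <> RtoC 0 /\ evalp q v <> RtoC 0.
Proof.
move=> hp hq.
pose L s : Cn n := fun j => (z j + RtoC s * (w j - z j))%C.
have L0 : L 0 = z by apply: functional_extensionality => j; rewrite /L; ring.
have L1 : L 1 = w by apply: functional_extensionality => j; rewrite /L; ring.
have [l hl] := line_poly_evalp p z w; have [m hm] := line_poly_evalp q z w.
rewrite -L0 in hp; rewrite -L1 in hq.
case: (peval_near0 l) => [e|[d [d0 hd]]]; first by case: hp; rewrite [LHS]hl.
case: (peval_near0 m) => [e|[d' [d'0 hd']]]; first by case: hq; rewrite [LHS]hm.
have m0 : 0 < Rmin d d' by apply: Rmin_case.
have r1 := Rmin_l d d'; have r2 := Rmin_r d d'.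
exists (L (Rmin d d' / 2)); split; rewrite ?[evalp p _]hl ?[evalp q _]hm.
  by apply: hd; lra.
by apply: hd'; lra.
Qed.

Definition mulp (n : nat) (p q : seq (C * expo n)) : seq (C * expo n) :=
  flatten [seq [seq (a.1 * b.1, fun d => (a.2 d + b.2 d)%N)%C | b <- q] | a <- p].

Lemma mono_add n (X Y : expo n) z : mono (fun d => X d + Y d)%N z = (mono X z * mono Y z)%C.
Proof.
rewrite /mono /monomial -cprod_mul; apply: cprod_ext => j.
by rewrite !cpow_add; ring.
Qed.

Lemma evalp_mulp n (p q : seq (C * expo n)) z : evalp (mulp p q) z = (evalp p z * evalp q z)%C.
Proof.
elim: p => [|a p ih]; first by rewrite /evalp /=; ring.
rewrite [LHS](lsum_cat _ _ (mulp p q)) -/(evalp (mulp p q) z) ih evalp_cons lsum_map.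
set g := (X in lsum X q).
have -> : lsum g q = (a.1 * mono a.2 z * evalp q z)%C.
  rewrite /evalp -lsum_scal; apply: eq_lsum => b; rewrite /g mono_add /=; ring.
by ring.
Qed.

Lemma quasi_hom_mulp n (lam : 'I_n -> R) (p q : seq (C * expo n)) a b a' b' :
  quasi_hom lam (evalp p) a b -> quasi_hom lam (evalp q) a' b' ->
  quasi_hom lam (evalp (mulp p q)) (a + a') (b + b').
Proof.
move=> [_ hp] [_ hq]; split; first by apply/is_poly_zzbarE; exists (mulp p q).
move=> t ht z; rewrite !evalp_mulp hp // hq // -!/(echar _ _ t) echar_plus; ring.
Qed.

Lemma rsum_ge0 n (g : 'I_n -> R) : (forall j, 0 <= g j) -> 0 <= rsum g.
Proof. by move=> h; rewrite /rsum; elim: (enum 'I_n) => /= [|j l ih]; [lra | have := h j; lra]. Qed.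

Lemma rsum_ge_term n (g : 'I_n -> R) j : (forall j, 0 <= g j) -> g j <= rsum g.
Proof.
move=> h; rewrite /rsum; have : j \in enum 'I_n by rewrite mem_enum.
have pos l : 0 <= List.fold_right (fun j acc => g j + acc) 0 l.
  by elim: l => /= [|i l ih]; [lra | have := h i; lra].
elim: (enum 'I_n) => //= i l ih; rewrite inE => /orP [/eqP ->|/ih hj].
  by have := pos l; lra.
by have := h i; lra.
Qed.

Lemma weight_ge0 n (lam : 'I_n -> R) b X : (forall j, 0 < lam j) -> 0 <= weight lam b X.
Proof. by move=> h; apply: rsum_ge0 => j; apply: Rmult_le_pos; [apply: Rlt_le | apply: pos_INR]. Qed.

Lemma weight_gt0 n (lam : 'I_n -> R) b X j : (forall j, 0 < lam j) -> X (j, b) <> 0%N ->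
  0 < weight lam b X.
Proof.
move=> h hj; apply: Rlt_le_trans (_ : lam j * INR (X (j, b)) <= _).
  apply: Rmult_lt_0_compat => //; apply: lt_0_INR; lia.
apply: (@rsum_ge_term _ (fun j => lam j * INR (X (j, b)))) => i.
by apply: Rmult_le_pos; [apply: Rlt_le | apply: pos_INR].
Qed.

Lemma weight_eq0 n (lam : 'I_n -> R) b (X : expo n) : (forall j, X (j, b) = 0%N) -> weight lam b X = 0.
Proof.
by move=> h; rewrite /weight /rsum; elim: (enum 'I_n) => //= j l ->; rewrite h /=; ring.
Qed.

Lemma quasi_hom_expsum n (lam : 'I_n -> R) (q : seq (C * expo n)) d1 d2 z t :
  quasi_hom lam (evalp q) d1 d2 -> 0 < Re t ->
  expsum ((- evalp q z, (d1, d2))%C :: leaf_terms lam z q) t = RtoC 0.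
Proof.
move=> [_ hq] ht; rewrite /expsum /= -/(expsum _ t) -evalp_Phi hq // -/(echar _ _ t); ring.
Qed.

(** Along the leaf of [z], q(z) times its own exponential cancels the expansion of [q] into
    monomials. Their weights are nonnegative, so for a negative [d2] nothing can balance the
    coefficient q(z). The exponential sum is identically zero, so any decay rate above [d1 + d2] may
    be fed to [expsum_coef]. *)
Lemma quasi_hom_d2_gt0 n (lam : 'I_n -> R) (q : seq (C * expo n)) d1 d2 z :
  (forall j, 0 < lam j) -> quasi_hom lam (evalp q) d1 d2 -> d2 <> 0 -> evalp q z <> RtoC 0 -> 0 < d2.
Proof.
move=> lp hq d20 qz; case: (Rlt_le_dec 0 d2) => // dn; case: qz.
have := @expsum_coef ((- evalp q z, (d1, d2))%C :: leaf_terms lam z q) d1 d2 (d1 + d2 + 1) 0 0.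
move=> H; have {H} := H ltac:(lra) _.
have -> : [seq tm <- (- evalp q z, (d1, d2))%C :: leaf_terms lam z q | exp_pred d1 d2 tm.2] =
   [:: (- evalp q z, (d1, d2))%C].
  rewrite /=; case: exp_predP => // _; congr cons.
  rewrite /leaf_terms; elim: (q) => //= tm s ih; case: exp_predP => //= -[_ e].
  by have := @weight_ge0 n lam true tm.2 lp; lra.
move=> H; have {H} : (- evalp q z + 0)%C = RtoC 0.
  by apply: H => t ht; rewrite quasi_hom_expsum // Cmod_0; lra.
by move=> h; have -> : evalp q z = (- (- evalp q z + 0))%C; [ring | rewrite h; ring].
Qed.

(** * Compactness *)

(** Identification of C^n with R^(2n) for [compactness_list], which concerns real boxes: index [2j]
    is the real part and [2j + 1] the imaginary part of coordinate [j]. *)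
Definition real_coords (n : nat) (w : Cn n) (i : nat) : R :=
  if (insub i./2 : option 'I_n) is Some j then if odd i then Im (w j) else Re (w j) else 0.

Definition of_real_coords (n m : nat) (t : Compactness.Tn m R) : Cn n :=
  fun j => (coeff_Tn 0 t j.*2, coeff_Tn 0 t j.*2.+1).

Lemma bounded_mk_Tn m (u : nat -> R) : (forall i, -1 <= u i <= 1) ->
  bounded_n m (mk_Tn m (fun _ => -1)) (mk_Tn m (fun _ => 1)) (mk_Tn m u).
Proof. by elim: m u => //= m ih u hu; split; [apply: hu | apply: (ih (fun i => u i.+1))]. Qed.

Lemma close_mk_Tn m d (u : nat -> R) (t : Compactness.Tn m R) i : close_n m d (mk_Tn m u) t ->
  (i < m)%N -> Rabs (u i - coeff_Tn 0 t i) < d.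
Proof.
elim: m u t i => // m ih u [t0 t] i /= [h0 h]; case: i => [|i] //=.
exact: ih h.
Qed.

(** Compactness as an induction principle: a property of sets that holds locally and passes to
    finite unions and to subsets holds for the closed polydisc. *)
Lemma polydisc_cover_induction n (K : (Cn n -> Prop) -> Prop) :
  (forall S T, K S -> K T -> K (fun w => S w \/ T w)) ->
  (forall S T : Cn n -> Prop, (forall w, T w -> S w) -> K S -> K T) ->
  K (fun _ => False) ->
  (forall z, exists d, 0 < d /\ K (fun w => near_pt z w d)) ->
  K (fun w => forall j, Cmod (w j) <= 1).
Proof.
move=> union sub empty loc; set m := n.*2.
have rad (t : Compactness.Tn m R) :
    {d : R | 0 < d /\ K (fun w => near_pt (of_real_coords t) w d)}.
  by apply: constructive_indefinite_description; apply: loc.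
(* Half the radius, since closeness of both real coordinates bounds the modulus by the sum of two
   errors. *)
have half0 t : 0 < proj1_sig (rad t) / 2 by case: (rad t) => d [d0 _] /=; lra.
(* [compactness_list] provides its finite list only under a double negation. *)
apply: NNPP => nK.
apply: (@compactness_list m (mk_Tn m (fun _ => -1)) (mk_Tn m (fun _ => 1))
  (fun t => mkposreal _ (half0 t))) => -[l hl]; apply: nK.
have : K (fun w => exists t, List.In t l /\ near_pt (of_real_coords t) w (proj1_sig (rad t))).
  elim: (l) => [|t l' ih]; first by apply: sub empty => w [t [[]]].
  have Kt : K (fun w => near_pt (of_real_coords t) w (proj1_sig (rad t))).
    by case: (rad t) => d [].
  apply: sub (union _ _ Kt ih) => w [t' [[->|it'] hw]]; first by left.
  by right; exists t'.
apply: sub => w hw.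
have wb i : -1 <= real_coords w i <= 1.
  rewrite /real_coords; case: insubP => [j _ _|_]; last lra.
  have h := hw j; have h1 := Rle_trans _ _ _ (re_le_Cmod (w j)) h.
  have h2 := Rle_trans _ _ _ (im_le_Cmod (w j)) h.
  have [] := proj1 (Rabs_le_between _ _) h1; have [] := proj1 (Rabs_le_between _ _) h2.
  by case: odd; lra.
have [t [tl [_ ht]]] := hl _ (bounded_mk_Tn m wb).
exists t; split=> // j.
have jlt : (j.*2 < m)%N by rewrite /m ltn_double.
have jlt' : (j.*2.+1 < m)%N by rewrite /m ltn_Sdouble.
have := close_mk_Tn ht jlt; have := close_mk_Tn ht jlt'.
rewrite /real_coords /= uphalf_double doubleK !valK odd_double /= => h1 h2.
apply: Rle_lt_trans (Cmod_le_ReIm _) _.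
rewrite /of_real_coords; set d := proj1_sig _ in h1 h2 *.
move: h1 h2; rewrite /Re /Im /= !/(Rminus _ _) => h1 h2; lra.
Qed.

(** * The two implications *)

Lemma cont_at_sqnorm n (z : Cn n) : cont_at (fun w => RtoC (rsum (fun j => Cmod (w j) ^ 2))) z.
Proof.
rewrite /rsum; elim: (enum 'I_n) => [|j l ih] /=; first exact: cont_at_const.
apply: (@cont_at_ext n (fun w => w j * Cconj (w j)
  + RtoC (List.fold_right (fun i acc => (Cmod (w i) ^ 2)%R + acc)%R 0%R l))%C).
  by exists 1; split; [lra | move=> w _ /=; rewrite RtoC_plus -Cmod2_conj].
by apply: cont_at_plus ih; apply: cont_at_mult; last apply: cont_at_conj; apply: cont_at_coord.
Qed.

Lemma cont_at_neq n (f : Cn n -> C) z c : cont_at f z -> f z <> c ->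
  exists d, 0 < d /\ forall w, near_pt z w d -> f w <> c.
Proof.
move=> cf ne; have p : 0 < Cmod (f z - c).
  by apply/Cmod_gt_0 => /Cminus_eq0.
have [d [d0 hd]] := cf _ p; exists d; split=> // w /hd h e.
by move: h; rewrite e Cmod_minus_sym; lra.
Qed.

Lemma sphere_Cmod_le1 n (z : Cn n) j : sphere z -> Cmod (z j) <= 1.
Proof.
move=> hz; have h := Cmod_ge_0 (z j).
have := @rsum_ge_term n (fun j => Cmod (z j) ^ 2) j (fun i => pow2_ge_0 _).
rewrite [X in _ <= X]hz; nra.
Qed.

Lemma closureS_incl n (F : Cn n -> Prop) z : (forall z, F z -> sphere z) -> F z -> closureS F z.
Proof.
move=> FS Fz; split; first exact: FS.
by move=> d d0; exists z; split=> //; apply: near_pt_refl.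
Qed.

(** The property fed to the compactness principle. It demands [0 < d2] and not just [d2 <> 0], so
    that products of witnesses are again witnesses. *)
Definition killable (n : nat) (lam : 'I_n -> R) (F S : Cn n -> Prop) : Prop :=
  exists (q : seq (C * expo n)) d1 d2, quasi_hom lam (evalp q) d1 d2 /\ 0 < d2 /\
    (exists w, evalp q w <> RtoC 0) /\ forall z, F z -> S z -> evalp q z = RtoC 0.

Lemma killable_sub n (lam : 'I_n -> R) F (S T : Cn n -> Prop) : (forall w, T w -> S w) ->
  killable lam F S -> killable lam F T.
Proof.
move=> TS [q [d1 [d2 [h1 [h2 [h3 h4]]]]]]; exists q, d1, d2; do 3 (split=> //).
by move=> z Fz /TS; apply: h4.
Qed.

Lemma killable_union n (lam : 'I_n -> R) F (S T : Cn n -> Prop) :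
  killable lam F S -> killable lam F T -> killable lam F (fun w => S w \/ T w).
Proof.
move=> [p [a [b [p1 [p2 [[z p3] p4]]]]]] [q [a' [b' [q1 [q2 [[w q3] q4]]]]]].
exists (mulp p q), (a + a'), (b + b'); split; first exact: quasi_hom_mulp.
split; first lra.
split.
  by have [v [v1 v2]] := evalp_mult_neq0 p3 q3; exists v; rewrite evalp_mulp; apply: Cmult_neq_0.
by move=> v Fv [/(p4 v Fv)|/(q4 v Fv)] e; rewrite evalp_mulp e; ring.
Qed.

(** Off the sphere, or off the closure of [F], a small neighborhood misses [F] and the witness for
    the empty set serves. At a point of the closure the leaf is sparse, which provides a polynomial
    vanishing on [F] nearby. *)
Lemma killable_near n (lam : 'I_n -> R) (F : Cn n -> Prop) z :
  (forall j, 0 < lam j) -> (forall z, F z -> sphere z) ->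
  killable lam F (fun _ => False) ->
  ~ (exists z, closureS F z /\ nonsparse_leaf lam F z) ->
  exists d, 0 < d /\ killable lam F (fun w => near_pt z w d).
Proof.
move=> lp FS [q0 [e1 [e2 [k1 [k2 [k3 _]]]]]] sparse.
have vacuous d : (forall w, F w -> ~ near_pt z w d) -> killable lam F (fun w => near_pt z w d).
  by move=> H; exists q0, e1, e2; do 3 (split=> //); move=> w /H.
case: (classic (sphere z)) => [Sz|nS]; last first.
  have ne : RtoC (rsum (fun j => Cmod (z j) ^ 2)) <> RtoC 1 by move/RtoC_inj.
  have [d [d0 hd]] := cont_at_neq (@cont_at_sqnorm n z) ne.
  exists d; split=> //; apply: vacuous => w /FS Sw /hd; apply.
  by rewrite [rsum _]Sw.
case: (classic (closureS F z)) => [cz|ncz]; last first.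
  apply: NNPP => H; apply: ncz; split=> // d d0.
  apply: NNPP => H'; apply: H; exists d; split=> //; apply: vacuous => w Fw hw.
  by apply: H'; exists w.
apply: NNPP => H; apply: sparse; exists z; split=> // U [US Uo] Uz q d1 d2 hq d20 kill w.
apply: NNPP => qw; apply: H.
have [s es] := (is_poly_zzbarE q).1 hq.1; subst q.
have [d [d0 hd]] := Uo z Uz.
exists d; split=> //; exists s, d1, d2; split=> //; split; first exact: (quasi_hom_d2_gt0 lp hq d20 qw).
split; first by exists w.
move=> v Fv hv; apply: kill; first exact: closureS_incl.
by apply: hd => //; apply: FS.
Qed.

(** The witness is the conjugate of z_j, of bidegree (0, [lam j]); a coordinate [j] must exist. *)
Lemma killable_empty n (lam : 'I_n -> R) F (j : 'I_n) : (forall j, 0 < lam j) ->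
  killable lam F (fun _ => False).
Proof.
move=> lp; pose X : expo n := fun d => nat_of_bool (d == (j, true)).
exists [:: (RtoC 1, X)], (weight lam false X), (weight lam true X).
split.
  split; first by apply/is_poly_zzbarE; exists [:: (RtoC 1, X)].
  by move=> t ht z; rewrite !evalp_cons /= mono_Phi /evalp /echar /=; ring.
split; first by apply: (@weight_gt0 _ _ _ _ j) => //; rewrite /X eqxx.
split=> //; exists (fun _ => RtoC 1).
have e : mono X (fun _ : 'I_n => RtoC 1) = RtoC 1.
  rewrite /mono /monomial /cprod; elim: (enum 'I_n) => //= i l ->.
  by rewrite Cconj_RtoC !cpow1; ring.
rewrite evalp_cons /= e /evalp /=.
have -> : (RtoC 1 * RtoC 1 + RtoC 0)%C = RtoC 1 by ring.
by apply: RtoC_neq0; lra.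
Qed.

Lemma exponent_bound n (X : expo n) : exists N, forall d, (X d <= N)%N.
Proof.
exists (\max_(d : 'I_n * bool) X d) => d; exact: leq_bigmax.
Qed.

Lemma large_multiple (mu M : R) k : 0 < mu -> exists N, (k <= N)%N /\ M < INR N * mu.
Proof.
move=> m0; have [N hN] := INR_unbounded (M / mu).
exists (k + N)%N; split; first exact: leq_addr.
rewrite -plusE plus_INR; have := pos_INR k => kp.
have -> : M = M / mu * mu by field; lra.
by apply: Rmult_lt_compat_r; lra.
Qed.

Lemma lam_min n (lam : 'I_n -> R) : (forall j, 0 < lam j) ->
  exists mu, 0 < mu /\ forall j, mu <= lam j.
Proof.
move=> lp; apply: (@ord_uniform_pos n (fun j r => r <= lam j)); first by move=> j r s; lra.
by move=> j; exists (lam j); split; [|apply: Rle_refl].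
Qed.

(** In the d-bar derivative along the leaf, the coefficient of bidegree (a, b) is [- 2 * b] times
    this component at [z]. It vanishes because its exponential decays more slowly than the error. *)
Lemma jet_component_zero n (lam : 'I_n -> R) N (f : Cn n -> C) z mu a b : 0 < mu ->
  (forall j, mu <= lam j) -> smooth f ->
  (forall t, Hplane t -> C_differentiable (fun s => f (Phi lam z s)) t) ->
  b <> 0 -> a + b < INR N * mu ->
  evalp [seq tm <- jet N f | exp_pred a b (weight lam false tm.2, weight lam true tm.2)] z = RtoC 0.
Proof.
move=> m0 hm sf hol b0 hN; have [X0 [K H]] := leaf_dbar N m0 hm sf hol.
have := expsum_coef hN H; rewrite /leaf_terms -map_comp filter_map lsum_map /=.
set g := lsum _ _ => gz.
have e : g = (RtoC (- 2 * b) * evalp [seq tm <- jet N f | exp_pred a b (weight lam false tm.2, weight lam true tm.2)] z)%C.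
  rewrite /g; elim: (jet N f) => [|tm s ih]; first by rewrite /evalp /=; ring.
  rewrite /=; case: exp_predP => // -[ea eb]; rewrite evalp_cons /= ih eb; ring.
have nz : RtoC (- 2 * b) <> RtoC 0 by apply: RtoC_neq0; lra.
set v := evalp _ z in e *.
have -> : v = (RtoC (- 2 * b) * v / RtoC (- 2 * b))%C by field.
by rewrite -e gz /Cdiv Cmult_0_l.
Qed.

Lemma quasi_hom_component n (lam : 'I_n -> R) (s : seq (C * expo n)) a b :
  quasi_hom lam (evalp [seq tm <- s | exp_pred a b (weight lam false tm.2, weight lam true tm.2)]) a b.
Proof.
split; first by apply/is_poly_zzbarE; eexists.
move=> t ht z; rewrite -/(echar a b t); elim: s => [|tm s ih]; first by rewrite /evalp /=; ring.
rewrite /=; case: exp_predP => // -[ea eb].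
by rewrite !evalp_cons ih mono_Phi ea eb; ring.
Qed.

Lemma taylor_coef_eq0 n (f : Cn n -> C) (k m : 'I_n -> nat) :
  taylor_coef f k m = RtoC 0 <-> foldW (word (join k m)) f (@origin n) = RtoC 0.
Proof.
rewrite /taylor_coef Dkm_word -/(@origin n).
have pos (g : 'I_n -> nat) : INR (nprod (fun j => (g j)`!)) <> 0.
  apply: not_0_INR; suff : (0 < nprod (fun j => (g j)`!))%N by case: nprod.
  by rewrite /nprod; elim: (enum 'I_n) => //= j l ih; rewrite muln_gt0 fact_gt0.
set c := (/ _)%R; have c0 : RtoC c <> RtoC 0.
  by apply: RtoC_neq0; apply: Rinv_neq_0_compat; apply: Rmult_integral_contrapositive.
split=> [h|->]; last by ring.
set v := foldW _ _ _ in h *.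
have -> : v = (RtoC c * v / RtoC c)%C by field.
by rewrite h /Cdiv Cmult_0_l.
Qed.

Lemma formal_Forelli_of_nonsparse n (lam : 'I_n -> R) (F : Cn n -> Prop) z0 :
  (forall j, 0 < lam j) -> closureS F z0 -> nonsparse_leaf lam F z0 -> formal_Forelli lam F.
Proof.
move=> lp [Sz0 _] ns f /smoothE sf hol k m [j mj].
have [mu [m0 hm]] := lam_min lp.
set X := join k m; set a := weight lam false X; set b := weight lam true X.
have bp : 0 < b by apply: (@weight_gt0 _ _ _ _ j).
have [k0 hk0] := exponent_bound X.
have [N [kN hN]] := large_multiple (a + b) k0 m0.
set s := [seq tm <- jet N f | exp_pred a b (weight lam false tm.2, weight lam true tm.2)].
have sF z : F z -> evalp s z = RtoC 0.
  by move=> Fz; apply: (@jet_component_zero n lam N f z mu) => //; [apply: hol | lra].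
have s0 w : evalp s w = RtoC 0.
  (* The component vanishes on all of [F], hence on its closure by continuity, so the whole sphere
     is taken as the neighborhood. *)
  apply: (ns (@sphere n) _ Sz0 _ a b); first by split=> // z _; exists 1; split; [lra|].
  - exact: quasi_hom_component.
  - lra.
  - move=> v [_ cv] _; apply: NNPP => ne.
    have [d [d0 hd]] := cont_at_neq (cont_at_evalp s v) ne.
    by have [u [Fu hu]] := cv d d0; apply: (hd u hu); apply: sF.
apply/taylor_coef_eq0.
(* [X] lies in its own component, so the derivative of [f] at the origin can be read off from a
   polynomial that is now known to be zero. *)
have := @foldW_jet n N f X (fun Y => exp_pred a b (weight lam false Y, weight lam true Y)).
rewrite -/s; case: exp_predP => // _ H; rewrite -/X -{}H; last first.
  by move=> d; apply: leq_trans (hk0 d) kN.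
have -> : evalp s = evalp [::] by apply: functional_extensionality => w; rewrite s0.
by rewrite foldW_evalp_origin.
Qed.

Lemma zero_C_differentiable (g : C -> C) t : Hplane t -> (forall s, Hplane s -> g s = RtoC 0) ->
  C_differentiable g t.
Proof.
(* The radius [Re t] keeps [t + h] in the half-plane. *)
move=> ht g0; exists (RtoC 0) => e e0; exists (Re t); split=> // h h0 hlt.
rewrite !g0 //; first by rewrite /Cdiv; have -> : ((RtoC 0 - RtoC 0) * / h - RtoC 0)%C = RtoC 0; [ring | rewrite Cmod_0].
rewrite /Hplane re_plus.
by have /Rabs_def2 [] := Rle_lt_trans _ _ _ (re_le_Cmod h) hlt; lra.
Qed.

(** Every jet coefficient of [q] of second weight [d2] would vanish, as a positive weight forces
    some exponent of a conjugate to be nonzero. Along the leaf of [w], -q(w) is then the only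
    coefficient of bidegree ([d1], [d2]) in an exponential sum that equals, up to sign, the fast
    decaying remainder. *)
Lemma not_formal_Forelli_of_killable n (lam : 'I_n -> R) (F : Cn n -> Prop) :
  (forall j, 0 < lam j) -> killable lam F F -> ~ formal_Forelli lam F.
Proof.
move=> lp [q [d1 [d2 [hq [d2p [[w qw] qF]]]]]] ff; apply: qw.
have sq := smooth_evalp q.
have [mu [m0 hm]] := lam_min lp.
have hol z : F z -> forall t, Hplane t -> C_differentiable (fun s => evalp q (Phi lam z s)) t.
  move=> Fz t ht; apply: zero_C_differentiable => // s hs.
  by rewrite hq.2 // qF //; ring.
have coef X : weight lam true X = d2 -> jet_coef (evalp q) X = RtoC 0.
  move=> eX; rewrite /jet_coef.
  have -> : X = join (fun j => X (j, false)) (fun j => X (j, true)).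
    by apply: functional_extensionality => -[j []].
  rewrite (_ : foldW _ _ _ = RtoC 0); first by rewrite /Cdiv Cmult_0_l.
  apply/taylor_coef_eq0; apply: ff => //; first exact/smoothE.
  apply: NNPP => H; suff : weight lam true X = 0 by lra.
  by apply: weight_eq0 => j; apply: NNPP => hj; apply: H; exists j.
have [N [_ hN]] := large_multiple (d1 + d2) 0 m0.
have fl := @flat_jet_remainder n N _ sq.
have sR : smooth (fun z => evalp q z - evalp (jet N (evalp q)) z)%C.
  have := smooth_lin (RtoC 1) (- RtoC 1)%C sq (smooth_evalp (jet N (evalp q))).
  set g := fun w => _; suff -> : g = (fun z => evalp q z - evalp (jet N (evalp q)) z)%C by [].
  by apply: functional_extensionality => v; rewrite /g; ring.
have [X0 [K [X00 H]]] := leaf_flat w m0 hm sR fl.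
set L := (- evalp q w, (d1, d2))%C :: leaf_terms lam w (jet N (evalp q)).
have hN' : d1 + d2 < INR N.+1 * mu by rewrite S_INR; lra.
have := @expsum_coef L d1 d2 _ X0 K hN' _.
have -> : lsum (fun tm => tm.1) [seq tm <- L | exp_pred d1 d2 tm.2] = (- evalp q w)%C.
  rewrite /L /=; case: exp_predP => // _ /=.
  suff -> : lsum (fun tm => tm.1) [seq tm <- leaf_terms lam w (jet N (evalp q)) | exp_pred d1 d2 tm.2] = RtoC 0 by ring.
  rewrite /leaf_terms /jet; elim: (enum _) => //= p l ih.
  by case: exp_predP => //= -[_ e]; rewrite ih coef //; ring.
move=> Z; have {Z} : (- evalp q w)%C = RtoC 0.
  apply: Z => t ht; have := H t ht.
  rewrite hq.2; last by rewrite /Hplane; lra.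
  rewrite -/(echar d1 d2 t) evalp_Phi -Cmod_opp; congr (_ <= _); congr Cmod.
  by rewrite /L /expsum /=; ring.
by move=> h; have -> : evalp q w = (- - evalp q w)%C; [ring | rewrite h; ring].
Qed.

Theorem theorem3p1 (n : nat) (lam : 'I_n -> R) :
  (0 < n)%N ->
  (forall i : 'I_n, nat_of_ord i = 0%N -> lam i = 1%R) ->
  (forall i : 'I_n, (0 < lam i)%R) ->
  forall F : Cn n -> Prop,
    (forall z, F z -> sphere z) ->
    (exists z, F z) ->
    (formal_Forelli lam F <-> exists z, closureS F z /\ nonsparse_leaf lam F z).
Proof.
move=> n0 _ lp F FS _; split; last first.
  by move=> [z [cz ns]]; apply: formal_Forelli_of_nonsparse cz ns.
move=> ff; apply: NNPP => sparse.
have empty := @killable_empty n lam F (Ordinal n0) lp.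
apply: (@not_formal_Forelli_of_killable n lam F lp) ff.
(* The sphere lies in the closed polydisc, so one polynomial obtained there kills all of [F]. *)
have := @polydisc_cover_induction n (killable lam F).
move=> H; apply: killable_sub (H _ _ _ _).
- by move=> w /FS Sw j; apply: sphere_Cmod_le1.
- by move=> S T; apply: killable_union.
- by move=> S T; apply: killable_sub.
- exact: empty.
- by move=> z; apply: killable_near.
Qed.
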